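(* Let $\mathbb{H}$ be the graded affine Hecke algebra attached to a root system $\Phi\subset V$ and a real parameter function $k$. Let $(\pi,X)$ be a one $W$-type $\mathbb{H}$-module. Then $\pi(\widetilde\omega)=0$ for all $\omega\in V$. In particular, an irreducible $W$-representation $\sigma$ can be extended to a one $W$-type $\mathbb{H}$-module (i.e. there is a one $W$-type $\mathbb{H}$-module whose restriction to $\mathbb{C}[W]$ is $\sigma$) if and only if $[\sigma(p_{\omega_1}),\sigma(p_{\omega_2})]=0$ for all $\omega_1,\omega_2\in V$.
   Context: $V$ is a finite-dimensional Euclidean space with inner product $(\ ,\ )$. $\Phi\subset V\setminus\{0\}$ is a finite reduced root system: $\Phi$ spans $V$; for $\alpha\in\Phi$ the reflection $s_\alpha(v)=v-\frac{2(\alpha,v)}{(\alpha,\alpha)}\alpha$ preserves $\Phi$; and $\alpha\in\Phi$ implies $2\alpha\notin\Phi$. $W\subset O(V)$ is the finite group generated by the $s_\alpha$, $\Phi^+$ a system of positive roots, $\Pi$ the simple roots, $w_0$ the longest element of $W$. $k:\Phi^+\to\mathbb{R}$, $\alpha\mapsto k_\alpha$, is $W$-invariant. $V_{\mathbb{C}}=V\otimes_{\mathbb R}\mathbb{C}$. The graded affine Hecke algebra $\mathbb{H}$ is the unital associative $\mathbb{C}$-algebra generated by $\{t_w:w\in W\}$ and $\{\omega\in V_{\mathbb{C}}\}$ (linear in $\omega$) with relations $t_wt_{w'}=t_{ww'}$; $\omega\omega'=\omega'\omega$; and $\omega t_{s_\alpha}-t_{s_\alpha}s_\alpha(\omega)=k_\alpha\frac{\omega-s_\alpha(\omega)}{\alpha}$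 for $\alpha\in\Pi$, $\omega\in V_{\mathbb C}$, where $\frac{\omega-s_\alpha(\omega)}{\alpha}$ is the scalar $\frac{2(\alpha,\omega)}{(\alpha,\alpha)}$ (with $(\ ,\ )$ extended bilinearly). The $t_w$ span a copy of $\mathbb{C}[W]$. $*$ is the conjugate-linear anti-involution of $\mathbb{H}$ with $t_w^*=t_{w^{-1}}$ for $w\in W$ and $\omega^*=-t_{w_0}\,w_0(\omega)\,t_{w_0}$ for $\omega\in V$. An $\mathbb{H}$-module $(\pi,X)$ is $*$-hermitian if $X$ has a nondegenerate hermitian form with $\langle\pi(h)x,y\rangle=\langle x,\pi(h^* )y\rangle$ for all $h\in\mathbb{H}$, $x,y\in X$. A one $W$-type module is a simple $*$-hermitian $\mathbb{H}$-module whose restriction to $\mathbb{C}[W]$ is irreducible. For $\omega\in V$: $p_\omega=\frac12\sum_{\alpha\in\Phi^+}k_\alpha\frac{\omega-s_\alpha(\omega)}{\alpha}\,t_{s_\alpha}\in\mathbb{C}[W]$, and $\widetilde\omega=\frac12(\omega-\omega^* )=\omega-p_\omega\in\mathbb{H}$.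
   Formalization: ''Reduced'' is taken to mean that the only real multiples of a root α lying in Φ are α and −α, instead of just 2α ∉ Φ; without integrality the literal condition leaves the simple roots and the identity ω̃ = ω − p_ω ill-defined (e.g. Φ = {±1, ±1.5}). *)

(* Defs.v *)
From HB Require Import structures.
From mathcomp Require Import all_boot all_order all_algebra.
From mathcomp Require Import boolp reals.
From mathcomp Require Import complex ring.

Set Implicit Arguments.
Unset Strict Implicit.
Unset Printing Implicit Defensive.

Import Order.TTheory GRing.Theory Num.Theory.
Local Open Scope ring_scope.
Local Open Scope quotient_scope.
Local Open Scope complex_scope.

(* The complexification of V: the pair (u, v) stands for u + i v. *)
Definition cplx (R : realType) (V : vectType R) : Type := (V * V)%type.

Section Complexification.
Variables (R : realType) (V : vectType R).

HB.instance Definition _ := GRing.Zmodule.copy (cplx V) (V * V)%type.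

Definition cplx_scale (c : R[i]) (x : cplx V) : cplx V :=
  (complex.Re c *: x.1 - complex.Im c *: x.2,
   complex.Re c *: x.2 + complex.Im c *: x.1).

Fact cplx_scaleA a b x :
  cplx_scale a (cplx_scale b x) = cplx_scale (a * b) x.
Proof.
case: a b x => [a1 a2] [b1 b2] [u v]; rewrite /cplx_scale /=; congr pair.
  rewrite scalerBr scalerDr !scalerA scalerBl scalerDl !opprD.
  by rewrite [- _ - (a2 * b2) *: u]addrC addrACA.
rewrite scalerBr scalerDr !scalerA scalerBl scalerDl.
by rewrite [_ - (a2 * b2) *: v]addrC addrACA.
Qed.

Fact cplx_scale1 : left_id 1 cplx_scale.
Proof.
by case=> u v; rewrite /cplx_scale /= !scale1r !scale0r subr0 addr0.
Qed.

Fact cplx_scaleDr : right_distributive cplx_scale +%R.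
Proof.
case=> [a1 a2] [u v] [u' v']; rewrite /cplx_scale /=; congr pair => /=.
  by rewrite !scalerDr opprD addrACA.
by rewrite !scalerDr addrACA.
Qed.

Fact cplx_scaleDl x : {morph cplx_scale^~ x : a b / a + b}.
Proof.
case: x => u v [a1 a2] [b1 b2]; rewrite /cplx_scale /=; congr pair => /=.
  by rewrite !scalerDl opprD addrACA.
by rewrite !scalerDl addrACA.
Qed.

HB.instance Definition _ := GRing.Zmodule_isLmodule.Build R[i] (cplx V)
  cplx_scaleA cplx_scale1 cplx_scaleDr cplx_scaleDl.

Definition of_real (v : V) : cplx V := (v, 0).

Definition cplx_map (f : 'End(V)) (x : cplx V) : cplx V := (f x.1, f x.2).

End Complexification.

Section RootSystems.
Variables (R : realType) (V : vectType R) (dotp : {dot V for idfun}).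

Definition reflection (a v : V) : V := v - (2 * dotp a v / dotp a a) *: a.

Fact reflection_is_linear a : linear (reflection a).
Proof.
move=> c u v; rewrite /reflection linearP mulrDr mulrDl scalerDl.
rewrite opprD addrACA scalerBr scalerA; congr (_ - _ *: _ + _).
by rewrite !mulrA (mulrC 2).
Qed.

HB.instance Definition _ a := GRing.isSemilinear.Build R V V *:%R (reflection a)
  (GRing.semilinear_linear (reflection_is_linear a)).

Definition refl (a : V) : 'End(V) := linfun (reflection a).

Definition refl_prod (s : seq V) : 'End(V) :=
  foldr (fun a f => (refl a \o f)%VF) \1%VF s.


(* Reflections are involutions, so these products form the group they
   generate. *)
Definition in_weyl (Phi : seq V) (w : 'End(V)) : Prop :=
  exists2 s : seq V, {subset s <= Phi} & w = refl_prod s.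

(* The last clause is reducedness. It is phrased for arbitrary real multiples
   because no integrality is imposed on Phi; for crystallographic Phi it is
   equivalent to 2 a \notin Phi. *)
Definition is_root_system (Phi : seq V) : Prop :=
  [/\ uniq Phi, 0 \notin Phi, <<Phi>>%VS = fullv,
      {in Phi &, forall a b, reflection a b \in Phi}
    & {in Phi, forall a c, c *: a \in Phi -> c = 1 \/ c = -1}].

Definition is_positive_system (Phi pos : seq V) : Prop :=
  uniq pos /\
  exists2 v : V, {in Phi, forall a, dotp v a != 0}
               & pos =i [pred a in Phi | 0 < dotp v a].

Definition is_simple_system (pos Pi : seq V) : Prop :=
  [/\ {subset Pi <= pos}, free Pi
    & {in pos, forall a, exists2 c : V -> R,
         (forall b, 0 <= c b) & a = \sum_(b <- Pi) c b *: b}].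

Definition reduced_word (Pi s : seq V) : Prop :=
  {subset s <= Pi} /\
  forall s' : seq V, {subset s' <= Pi} -> refl_prod s' = refl_prod s ->
    (size s <= size s')%N.

Definition is_longest (Pi : seq V) (w : 'End(V)) : Prop :=
  exists2 s : seq V, reduced_word Pi s /\ w = refl_prod s
    & forall s' : seq V, reduced_word Pi s' -> (size s' <= size s)%N.

Definition weyl_invariant (Phi pos : seq V) (k : V -> R) : Prop :=
  forall (w : 'End(V)) (a : V),
    in_weyl Phi w -> a \in pos -> w a \in pos -> k (w a) = k a.

Fact refl_prod_cat s1 s2 :
  refl_prod (s1 ++ s2) = (refl_prod s1 \o refl_prod s2)%VF.
Proof.
by elim: s1 => [|a s1 IH] /=; rewrite ?comp_lfun1l // IH comp_lfunA.
Qed.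

Fact reflE a v : refl a v = v - (2 * dotp a v / dotp a a) *: a.
Proof. by rewrite lfunE. Qed.

Fact reflK a : a != 0 -> (refl a \o refl a = \1)%VF.
Proof.
move=> a0; apply/lfunP => v; rewrite comp_lfunE id_lfunE !reflE.
have d0 : dotp a a != 0 by rewrite gt_eqF // neq0_dnorm_gt0.
set c := 2 * dotp a v / dotp a a.
have -> : 2 * dotp a (v - c *: a) / dotp a a = - c.
  rewrite linearB linearZ /= mulrBr mulrBl -/c mulrA mulfK //.
  by rewrite mulr_natl mulr2n opprD addrA subrr sub0r.
by rewrite scaleNr opprK subrK.
Qed.

Fact refl_prod_rev s : 0 \notin s ->
  (refl_prod (rev s) \o refl_prod s = \1)%VF.
Proof.
elim: s => [|a s IH] /=; first by rewrite comp_lfun1l.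
rewrite inE negb_or eq_sym => /andP[a0 /IH s0].
rewrite rev_cons -cats1 refl_prod_cat /= comp_lfun1r.
by rewrite -comp_lfunA (comp_lfunA (refl a)) reflK // comp_lfun1l.
Qed.

End RootSystems.

(* Only the values of param on pos are meaningful. *)
Record hecke_datum (R : realType) (V : vectType R) := HeckeDatum {
  dotp : {dot V for idfun};
  roots : seq V;
  pos : seq V;
  simple : seq V;
  longest : 'End(V);
  param : V -> R;
  rootsP : is_root_system dotp roots;
  posP : is_positive_system dotp roots pos;
  simpleP : is_simple_system pos simple;
  longestP : is_longest dotp simple longest;
  paramP : weyl_invariant dotp roots pos param
}.

Section WeylGroup.
Variables (R : realType) (V : vectType R) (D : hecke_datum V).

Record weyl := Weyl {
  weyl_val :> 'End(V);
  weyl_subproof : `[< in_weyl (dotp D) (roots D) weyl_val >]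
}.

HB.instance Definition _ := [isSub of weyl for weyl_val].
HB.instance Definition _ := [Choice of weyl by <:].

Fact weylP (w : weyl) : in_weyl (dotp D) (roots D) w.
Proof. exact: asboolW (weyl_subproof w). Qed.

Fact simple_roots : {subset simple D <= roots D}.
Proof.
move=> a /(let: And3 h _ _ := simpleP D in h a).
by have [_ [v _ ->]] := posP D; case/andP.
Qed.

Fact root_neq0 a : a \in roots D -> a != 0.
Proof. by have [_ n0 _ _ _] := rootsP D; apply: contraTneq => ->. Qed.

Fact weyl1_subproof : `[< in_weyl (dotp D) (roots D) \1%VF >].
Proof. by apply/asboolP; exists [::]. Qed.

Fact weylM_subproof (w w' : weyl) :
  `[< in_weyl (dotp D) (roots D) (w \o w')%VF >].
Proof.
have [s sP ->] := weylP w; have [s' sP' ->] := weylP w'.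
apply/asboolP; exists (s ++ s'); last by rewrite refl_prod_cat.
by move=> a; rewrite mem_cat => /orP[/sP|/sP'].
Qed.

Fact weyl_rev (w : weyl) : exists s, [/\ {subset s <= roots D},
  (refl_prod (dotp D) s \o w = \1)%VF & (w \o refl_prod (dotp D) s = \1)%VF].
Proof.
have [s sP ->] := weylP w; exists (rev s); split.
- by move=> a; rewrite mem_rev; apply: sP.
- by apply: refl_prod_rev; apply/negP => /sP/root_neq0; rewrite eqxx.
rewrite -{1}[s]revK; apply: refl_prod_rev; rewrite mem_rev.
by apply/negP => /sP/root_neq0; rewrite eqxx.
Qed.

Fact weyl_invE (w : weyl) : exists s, [/\ {subset s <= roots D},
  (w^-1 = refl_prod (dotp D) s)%VF, (w^-1 \o w = \1)%VF &
  (w \o w^-1 = \1)%VF].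
Proof.
have [s [sP sw ws]] := weyl_rev w.
have kw : lker w == 0%VS.
  by apply/lker0P => x y /(congr1 (refl_prod (dotp D) s));
     rewrite -!comp_lfunE sw !id_lfunE.
have e : (w^-1 = refl_prod (dotp D) s)%VF.
  by rewrite -[LHS]comp_lfun1r -ws comp_lfunA lker0_compVf // comp_lfun1l.
by exists s; rewrite e.
Qed.

Fact weylV_subproof (w : weyl) : `[< in_weyl (dotp D) (roots D) w^-1%VF >].
Proof. by have [s [sP e _ _]] := weyl_invE w; apply/asboolP; exists s. Qed.

Definition weyl_one := Weyl weyl1_subproof.
Definition weyl_mul w w' := Weyl (weylM_subproof w w').
Definition weyl_inv w := Weyl (weylV_subproof w).

Fact weyl_mulA : associative weyl_mul.
Proof. by move=> x y z; apply: val_inj; rewrite /= comp_lfunA. Qed.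
Fact weyl_mul1 : left_id weyl_one weyl_mul.
Proof. by move=> x; apply: val_inj; rewrite /= comp_lfun1l. Qed.
Fact weyl_1mul : right_id weyl_one weyl_mul.
Proof. by move=> x; apply: val_inj; rewrite /= comp_lfun1r. Qed.
Fact weyl_mulV : left_inverse weyl_one weyl_inv weyl_mul.
Proof.
by move=> x; apply: val_inj => /=; have [s [_ _ -> _]] := weyl_invE x.
Qed.
Fact weyl_Vmul : right_inverse weyl_one weyl_inv weyl_mul.
Proof.
by move=> x; apply: val_inj => /=; have [s [_ _ _ ->]] := weyl_invE x.
Qed.

HB.instance Definition _ := isGroup.Build weyl
  weyl_mulA weyl_mul1 weyl_1mul weyl_mulV weyl_Vmul.

(* The reflection in a as an element of W; the default value 1 is only taken
   when that reflection is not in W, hence never for a root a. *)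
Definition weyl_refl (a : V) : weyl := insubd (1%g : weyl) (refl (dotp D) a).

Fact longest_subproof : `[< in_weyl (dotp D) (roots D) (longest D) >].
Proof.
have [s [[sP _] ->] _] := longestP D.
by apply/asboolP; exists s => // a /sP/simple_roots.
Qed.

Definition weyl_longest : weyl := Weyl longest_subproof.

(* The scalar (x - s_a(x)) / a = 2 (a, x) / (a, a), with the inner product
   extended bilinearly to the complexification. *)
Definition coroot_pairing (a : V) (x : cplx V) : R[i] :=
  2 * (dotp D a x.1 +i* dotp D a x.2) / (dotp D a a)%:C.

End WeylGroup.

Section HeckeAlgebra.
Variables (R : realType) (V : vectType R) (D : hecke_datum V).

(* The graded Hecke algebra is the quotient of the terms in its generators by
   the least congruence containing the axioms of unital associative
   R[i]-algebras (the scalar c being the term HK c) and the defining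
   relations. *)
Inductive hterm :=
  | HK of R[i]
  | HT of weyl D
  | HV of cplx V
  | HAdd of hterm & hterm
  | HMul of hterm & hterm.

Inductive hrel : hterm -> hterm -> Prop :=
  | hrel_refl x : hrel x x
  | hrel_sym x y : hrel x y -> hrel y x
  | hrel_trans x y z : hrel x y -> hrel y z -> hrel x z
  | hrel_add x x' y y' : hrel x x' -> hrel y y' -> hrel (HAdd x y) (HAdd x' y')
  | hrel_mul x x' y y' : hrel x x' -> hrel y y' -> hrel (HMul x y) (HMul x' y')
  | hrel_addA x y z : hrel (HAdd x (HAdd y z)) (HAdd (HAdd x y) z)
  | hrel_addC x y : hrel (HAdd x y) (HAdd y x)
  | hrel_add0 x : hrel (HAdd (HK 0) x) x
  | hrel_addN x : hrel (HAdd (HMul (HK (-1)) x) x) (HK 0)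
  | hrel_mulA x y z : hrel (HMul x (HMul y z)) (HMul (HMul x y) z)
  | hrel_mul1 x : hrel (HMul (HK 1) x) x
  | hrel_mulDl x y z : hrel (HMul (HAdd x y) z) (HAdd (HMul x z) (HMul y z))
  | hrel_mulDr x y z : hrel (HMul x (HAdd y z)) (HAdd (HMul x y) (HMul x z))
  | hrel_KD a b : hrel (HK (a + b)) (HAdd (HK a) (HK b))
  | hrel_KM a b : hrel (HK (a * b)) (HMul (HK a) (HK b))
  | hrel_KC a x : hrel (HMul (HK a) x) (HMul x (HK a))
  | hrel_T1 : hrel (HT 1%g) (HK 1)
  | hrel_TM w w' : hrel (HMul (HT w) (HT w')) (HT (w * w')%g)
  | hrel_VD a x y : hrel (HV (a *: x + y)) (HAdd (HMul (HK a) (HV x)) (HV y))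
  | hrel_VC x y : hrel (HMul (HV x) (HV y)) (HMul (HV y) (HV x))
  | hrel_VT a x : a \in simple D ->
      hrel (HMul (HV x) (HT (weyl_refl D a)))
           (HAdd (HMul (HT (weyl_refl D a)) (HV (cplx_map (weyl_refl D a) x)))
                 (HK ((param D a)%:C * coroot_pairing D a x))).

HB.instance Definition _ := gen_eqMixin hterm.
HB.instance Definition _ := gen_choiceMixin hterm.

Definition hrelb (x y : hterm) : bool := `[< hrel x y >].

Fact hrelb_equiv : equiv_class_of hrelb.
Proof.
split=> [x|x y|y x z].
- exact/asboolP/hrel_refl.
- by apply/asboolP/asboolP; apply: hrel_sym.
- by move=> /asboolP xy /asboolP yz; apply/asboolP; apply: hrel_trans xy yz.
Qed.

Canonical hrel_equiv := EquivRelPack hrelb_equiv.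

Definition hecke := {eq_quot hrel_equiv}.

HB.instance Definition _ := Choice.on hecke.
HB.instance Definition _ := EqQuotient.on hecke.

Definition hclass (x : hterm) : hecke := \pi_hecke x.

Fact hclassP x y : hclass x = hclass y <-> hrel x y.
Proof.
split=> [/eqP|xy]; last by apply/eqP; rewrite eqmodE; apply/asboolP.
by rewrite eqmodE => /asboolP.
Qed.

Fact hclass_repr (x : hecke) : hclass (repr x) = x.
Proof. exact: reprK. Qed.

Fact hrepr_class x : hrel (repr (hclass x)) x.
Proof. by apply/hclassP; rewrite hclass_repr. Qed.

Definition hadd (x y : hecke) := hclass (HAdd (repr x) (repr y)).
Definition hmul (x y : hecke) := hclass (HMul (repr x) (repr y)).
Definition hopp (x : hecke) := hclass (HMul (HK (-1)) (repr x)).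
Definition hscale (c : R[i]) (x : hecke) := hclass (HMul (HK c) (repr x)).

Fact hclassD x y : hadd (hclass x) (hclass y) = hclass (HAdd x y).
Proof. by apply/hclassP/hrel_add; apply: hrepr_class. Qed.
Fact hclassM x y : hmul (hclass x) (hclass y) = hclass (HMul x y).
Proof. by apply/hclassP/hrel_mul; apply: hrepr_class. Qed.
Fact hclassN x : hopp (hclass x) = hclass (HMul (HK (-1)) x).
Proof. by apply/hclassP/hrel_mul; [exact: hrel_refl|exact: hrepr_class]. Qed.
Fact hclassZ c x : hscale c (hclass x) = hclass (HMul (HK c) x).
Proof. by apply/hclassP/hrel_mul; [exact: hrel_refl|exact: hrepr_class]. Qed.

Fact hclass_ind (P : hecke -> Prop) :
  (forall x, P (hclass x)) -> forall h, P h.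
Proof. by move=> Pc h; rewrite -(hclass_repr h). Qed.

Fact haddA : associative hadd.
Proof.
elim/hclass_ind=> x; elim/hclass_ind=> y; elim/hclass_ind=> z.
by rewrite !hclassD; apply/hclassP/hrel_addA.
Qed.
Fact haddC : commutative hadd.
Proof.
elim/hclass_ind=> x; elim/hclass_ind=> y.
by rewrite !hclassD; apply/hclassP/hrel_addC.
Qed.
Fact hadd0 : left_id (hclass (HK 0)) hadd.
Proof. by elim/hclass_ind=> x; rewrite hclassD; apply/hclassP/hrel_add0. Qed.
Fact haddN : left_inverse (hclass (HK 0)) hopp hadd.
Proof.
by elim/hclass_ind=> x; rewrite hclassN hclassD; apply/hclassP/hrel_addN.
Qed.

HB.instance Definition _ := GRing.isZmodule.Build hecke haddA haddC hadd0 haddN.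

Fact hmulA : associative hmul.
Proof.
elim/hclass_ind=> x; elim/hclass_ind=> y; elim/hclass_ind=> z.
by rewrite !hclassM; apply/hclassP/hrel_mulA.
Qed.
Fact hmul1 : left_id (hclass (HK 1)) hmul.
Proof. by elim/hclass_ind=> x; rewrite hclassM; apply/hclassP/hrel_mul1. Qed.
Fact h1mul : right_id (hclass (HK 1)) hmul.
Proof.
elim/hclass_ind=> x; rewrite hclassM; apply/hclassP.
exact: hrel_trans (hrel_sym (hrel_KC 1 x)) (hrel_mul1 x).
Qed.
Fact hmulDl : left_distributive hmul +%R.
Proof.
elim/hclass_ind=> x; elim/hclass_ind=> y; elim/hclass_ind=> z.
by rewrite /GRing.add /= !(hclassM, hclassD); apply/hclassP/hrel_mulDl.
Qed.
Fact hmulDr : right_distributive hmul +%R.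
Proof.
elim/hclass_ind=> x; elim/hclass_ind=> y; elim/hclass_ind=> z.
by rewrite /GRing.add /= !(hclassM, hclassD); apply/hclassP/hrel_mulDr.
Qed.

(* Nontriviality: t_w |-> 1, x |-> hweight x, where hweight a = k_a for a
   simple, is a character of the algebra. *)
Definition hweight (v : V) : R :=
  \sum_(i < size (simple D)) param D (simple D)`_i * coord (in_tuple (simple D)) i v.

Fact hweight_linear : scalar hweight.
Proof.
move=> c u v; rewrite /hweight mulr_sumr -big_split; apply: eq_bigr => i _ /=.
by rewrite linearP mulrDr mulrCA.
Qed.

Fact hweight_simple a : a \in simple D -> hweight a = param D a.
Proof.
move=> aS; have [_ fS _] := simpleP D.
have ltS : (index a (simple D) < size (simple D))%N by rewrite index_mem.
pose j := Ordinal ltS.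
have ja : (in_tuple (simple D))`_j = a by rewrite /= nth_index.
rewrite /hweight (bigD1 j) //= big1 => [|i ij]; last first.
  by rewrite -[in X in coord _ _ X]ja coord_free // eq_sym (negPf ij) mulr0.
by rewrite -[in X in coord _ _ X]ja coord_free // eqxx mulr1 addr0 nth_index.
Qed.

Fact hweightB u v : hweight (u - v) = hweight u - hweight v.
Proof. by rewrite -scaleN1r addrC hweight_linear mulN1r addrC. Qed.

Fact hweightZ c v : hweight (c *: v) = c * hweight v.
Proof.
by rewrite -[c *: v]addr0 hweight_linear -(subrr v) hweightB subrr addr0.
Qed.

Fact hweightD u v : hweight (u + v) = hweight u + hweight v.
Proof. by rewrite -[v in LHS]opprK hweightB -[- v]scaleN1r hweightZ mulN1r opprK. Qed.

Fixpoint heval (x : hterm) : R[i] :=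
  match x with
  | HK c => c
  | HT _ => 1
  | HV v => hweight v.1 +i* hweight v.2
  | HAdd y z => heval y + heval z
  | HMul y z => heval y * heval z
  end.

Fact weyl_reflE a : a \in roots D -> weyl_refl D a = refl (dotp D) a :> 'End(V).
Proof.
move=> aR; rewrite /weyl_refl val_insubd ifT //; apply/asboolP.
exists [:: a]; last by rewrite /= comp_lfun1r.
by move=> b; rewrite inE => /eqP ->.
Qed.

Fact heval_rel x y : hrel x y -> heval x = heval y.
Proof.
elim=> //=.
- by move=> ? ? ? _ -> _ ->.
- by move=> ? ? ? ? _ -> _ ->.
- by move=> ? ? ? ? _ -> _ ->.
- by move=> *; rewrite addrA.
- by move=> *; rewrite addrC.
- by move=> *; rewrite add0r.
- by move=> *; rewrite mulN1r addNr.
- by move=> *; rewrite mulrA.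
- by move=> *; rewrite mul1r.
- by move=> *; rewrite mulrDl.
- by move=> *; rewrite mulrDr.
- by move=> *; rewrite mulrC.
- by move=> *; rewrite mul1r.
- move=> [a1 a2] [u v] [u' v'].
  transitivity (hweight (a1 *: u - a2 *: v + u')
                +i* hweight (a1 *: v + a2 *: u + v')); first by [].
  apply/eqP; rewrite eq_complex /=.
  by rewrite hweightD hweightB !hweightD !hweightZ !eqxx.
- by move=> *; rewrite mulrC.
move=> a [u v] aS; rewrite mulr1 mul1r.
have aR := simple_roots aS.
rewrite /= weyl_reflE // !reflE !hweightB !hweightZ (hweight_simple aS).
rewrite /coroot_pairing -fmorphV.
by apply/eqP; rewrite eq_complex /=; apply/andP; split; apply/eqP; ring.
Qed.

Fact hone_neq0 : hclass (HK 1) != 0.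
Proof.
by apply/eqP => /hclassP/heval_rel /=; apply/eqP; rewrite oner_eq0.
Qed.

HB.instance Definition _ :=
  GRing.Zmodule_isNzRing.Build hecke hmulA hmul1 h1mul hmulDl hmulDr hone_neq0.

Fact hscaleE c x : hscale c x = hclass (HK c) * x.
Proof. by elim/hclass_ind: x => x; rewrite hclassZ -hclassM. Qed.

Fact hscaleA a b x : hscale a (hscale b x) = hscale (a * b) x.
Proof.
rewrite !hscaleE mulrA; congr (_ * _); rewrite /GRing.mul /= hclassM.
exact/hclassP/hrel_sym/hrel_KM.
Qed.
Fact hscale1 : left_id 1 hscale.
Proof. by move=> x; rewrite hscaleE; apply: hmul1. Qed.
Fact hscaleDr : right_distributive hscale +%R.
Proof. by move=> c x y; rewrite !hscaleE mulrDr. Qed.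
Fact hscaleDl x : {morph hscale^~ x : a b / a + b}.
Proof.
move=> a b /=; rewrite !hscaleE -mulrDl; congr (_ * _).
rewrite [RHS]hclassD; exact/hclassP/hrel_KD.
Qed.

HB.instance Definition _ := GRing.Zmodule_isLmodule.Build R[i] hecke
  hscaleA hscale1 hscaleDr hscaleDl.

Fact hscaleAl (c : R[i]) (x y : hecke) : c *: (x * y) = (c *: x) * y.
Proof. by rewrite /GRing.scale /= !hscaleE mulrA. Qed.
HB.instance Definition _ := GRing.Lmodule_isLalgebra.Build R[i] hecke hscaleAl.

Fact hscaleAr (c : R[i]) (x y : hecke) : c *: (x * y) = x * (c *: y).
Proof.
rewrite /GRing.scale /= !hscaleE !mulrA; congr (_ * _).
elim/hclass_ind: x => x; rewrite /GRing.mul /= !hclassM.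
exact/hclassP/hrel_KC.
Qed.
HB.instance Definition _ := GRing.Lalgebra_isAlgebra.Build R[i] hecke hscaleAr.

Definition hT (w : weyl D) : hecke := hclass (HT w).
Definition hV (x : cplx V) : hecke := hclass (HV x).

End HeckeAlgebra.

Section Modules.
Variables (R : realType) (V : vectType R) (D : hecke_datum V).

Definition hreal (v : V) : hecke D := hV D (of_real v).

Definition is_star (star : hecke D -> hecke D) : Prop :=
  [/\ forall (c : R[i]) g h, star (c *: g + h) = conjc c *: star g + star h,
      forall g h, star (g * h) = star h * star g,
      involutive star,
      forall w : weyl D, star (hT w) = hT w^-1%g
    & forall v : V, star (hreal v) =
        - (hT (weyl_longest D) * hreal (longest D v) * hT (weyl_longest D))].

Definition tilde (star : hecke D -> hecke D) (v : V) : hecke D :=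
  (2^-1 : R[i]) *: (hreal v - star (hreal v)).

(* The image of the element p_v of C[W] under the linear extension of T. *)
Definition p_image (M : lmodType R[i]) (T : weyl D -> M) (v : V) : M :=
  (2^-1 : R[i]) *: \sum_(a <- pos D)
     ((param D a)%:C * coroot_pairing D a (of_real v)) *: T (weyl_refl D a).

Section Representations.
Variable X : lmodType R[i].

(* Irreducibility of a family of operators: X is nonzero and has no proper
   nonzero subspace stable under all of them. *)
Definition irreducible_family (I : Type) (f : I -> X -> X) : Prop :=
  (exists x : X, x <> 0) /\
  forall S : X -> Prop,
    S 0 -> (forall (c : R[i]) x y, S x -> S y -> S (c *: x + y)) ->
    (forall i x, S x -> S (f i x)) ->
    (forall x, S x -> x = 0) \/ (forall x, S x).

Definition is_weyl_rep (sigma : weyl D -> X -> X) : Prop :=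
  [/\ forall w, linear (sigma w),
      forall x, sigma 1%g x = x
    & forall w w' x, sigma (w * w')%g x = sigma w (sigma w' x)].

Definition rep_p (sigma : weyl D -> X -> X) (v : V) (x : X) : X :=
  p_image (fun w => sigma w x) v.

Definition is_hecke_module (act : hecke D -> X -> X) : Prop :=
  [/\ forall h, linear (act h),
      forall (c : R[i]) g h x, act (c *: g + h) x = c *: act g x + act h x,
      forall x, act 1 x = x
    & forall g h x, act (g * h) x = act g (act h x)].

Definition is_star_hermitian (star : hecke D -> hecke D)
    (act : hecke D -> X -> X) : Prop :=
  exists f : {hermitian_sym X for (@conjc R)},
    (forall x, (forall y, f x y = 0) -> x = 0) /\
    forall h x y, f (act h x) y = f x (act (star h) y).

Definition one_W_type (star : hecke D -> hecke D)
    (act : hecke D -> X -> X) : Prop :=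
  [/\ is_hecke_module act,
      irreducible_family act,
      is_star_hermitian star act
    & irreducible_family (fun w => act (hT w))].

End Representations.

End Modules.

(* Main.v *)
Require Import Defs.
From HB Require Import structures.
From mathcomp Require Import all_boot all_order all_algebra.
From mathcomp Require Import boolp reals complex.
From mathcomp Require Import ring lra.

(* Write omega = tilde omega + p_omega. The elements tilde omega transform under W
   like vectors of V, and p_omega is self-adjoint. On a one W-type module the
   invariant form is, by Schur's lemma, a multiple of the W-invariant inner
   product, so tilde omega acts by a skew-adjoint operator. Two steps show that it
   acts by zero.

   (1) The joint eigenvalues of V are real. Let v be a joint eigenvector whose
   weight has imaginary part nu; intertwiners allow nu to be dominant. As
   omega^* is -omega twisted by w_0, the vector t_{w_0} v is orthogonal to all
   generalized weight vectors but those of one weight, and triangularity of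
   the t_w on weights yields <t_w v, v> = 0 unless w nu = nu. If a root
   reflection s moved nu, the Schur orthogonality relation for the coefficients
   <t_w v, v> and <t_{sws} v, v> would read 0 = sum of |<t_w v, v>|^2 over the w
   fixing nu and the root, a set that contains 1.

   (2) By Schur orthogonality it suffices that tr(tilde omega t_w) = 0, and by
   equivariance that omega be dominant and fixed by w. Then omega, p_omega and
   tilde omega commute with t_u for all u in the stabilizer C of omega. For the
   skew-adjoint element h = sum over C of tr(tilde omega t_u^-1) t_u the traces
   tr(h omega) and tr(h p_omega) are imaginary, the first because omega has real
   spectrum and commutes with h, while tr(h tilde omega) is minus the sum of
   |tr(tilde omega t_u)|^2. All these numbers therefore vanish.

   Conversely, when the p_omega commute, letting omega act by p_omega defines a
   module. *)

Set Implicit Arguments.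
Unset Strict Implicit.
Unset Printing Implicit Defensive.

Import Order.TTheory GRing.Theory Num.Theory.
Local Open Scope ring_scope.

(* MathComp's fingraph also defines [roots]. *)
Local Notation roots := Defs.roots.

(** * Root systems and Weyl groups *)

Section ExistsMax.
Variable R : realType.

Lemma exists_seq_max (T : eqType) (s : seq T) (P : T -> Prop) (f : T -> R) x0 :
  x0 \in s -> P x0 ->
  exists x, [/\ x \in s, P x & forall y, y \in s -> P y -> f y <= f x].
Proof.
elim: s x0 => // z s IH x0 x0s Px0.
have [[y ys Py]|no] := pselect (exists2 y, y \in s & P y); last first.
  have x0z : x0 = z.
    by move: x0s; rewrite inE => /orP[/eqP//|x0s]; case: no; exists x0.
  exists z; rewrite mem_head -x0z; split=> // y.
  by rewrite inE x0z => /orP[/eqP -> //|ys Py]; case: no; exists y.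
have [x [xs Px xmax]] := IH y ys Py.
have [[Pz fz]|nz] := pselect (P z /\ f x < f z).
  exists z; rewrite mem_head; split=> // u; rewrite inE => /orP[/eqP -> //|us Pu].
  exact: le_trans (xmax u us Pu) (ltW fz).
exists x; rewrite inE xs orbT; split=> // u.
rewrite inE => /orP[/eqP -> Pz|]; last exact: xmax.
by rewrite leNgt; apply/negP => fz; apply: nz.
Qed.

(** A counterexample with [f] largest would contradict the hypothesis. This serves as induction
    along heights of roots and of group elements. *)
Lemma seq_gt_ind (T : eqType) (s : seq T) (f : T -> R) (P : T -> Prop) :
  (forall x, x \in s -> (forall y, y \in s -> f x < f y -> P y) -> P x) ->
  forall x, x \in s -> P x.
Proof.
move=> IH x xs; apply: contrapT => nPx.
have [y [ys nPy ymax]] := exists_seq_max f xs nPx (P := fun x => ~ P x).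
apply: nPy; apply: IH => // z zs fyz; apply: contrapT => nPz.
by have := ymax z zs nPz; rewrite leNgt fyz.
Qed.

End ExistsMax.

Lemma free_coef (R : realType) (V : vectType R) (s : seq V) (c : V -> R) :
  free s -> \sum_(b <- s) c b *: b = 0 -> {in s, forall b, c b = 0}.
Proof.
move=> fs c0 b bs; have ib : (index b s < size s)%N by rewrite index_mem.
have /freeP/(_ (fun i => c s`_i)) : free (in_tuple s) by [].
move=> /(_ _ (Ordinal ib)); rewrite /= nth_index //; apply.
by rewrite -[RHS]c0 (big_nth 0) big_mkord.
Qed.

(** * Positive roots, words in simple reflections and the longest element *)

Section Roots.
Variables (R : realType) (V : vectType R) (D : hecke_datum V).
Local Notation dp := (dotp D).
Implicit Types (a b x y : V) (w : weyl D).

Definition coroot a x : R := 2 * dp a x / dp a a.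

Lemma dotC x y : dp x y = dp y x.
Proof. by rewrite hermC /= expr0 mul1r. Qed.

Lemma dot_gt0 x : x != 0 -> 0 < dp x x.
Proof. exact: neq0_dnorm_gt0. Qed.

Lemma reflEc a x : refl dp a x = x - coroot a x *: a.
Proof. exact: reflE. Qed.

Lemma coroot_linear a : scalar (coroot a).
Proof. by move=> c x y; rewrite /coroot linearPr /=; ring. Qed.
HB.instance Definition _ a :=
  GRing.isSemilinear.Build R V R *%R (coroot a)
    (GRing.semilinear_linear (coroot_linear a)).

Lemma corootaa a : a != 0 -> coroot a a = 2.
Proof. by move=> /dot_gt0 a0; rewrite /coroot mulfK // gt_eqF. Qed.

Lemma coroot_gt0 a x : a != 0 -> (0 < coroot a x) = (0 < dp a x).
Proof.
by move=> /dot_gt0 a0; rewrite /coroot pmulr_lgt0 ?invr_gt0 // pmulr_rgt0 ?ltr0n.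
Qed.

Lemma coroot_ge0 a x : a != 0 -> (0 <= coroot a x) = (0 <= dp a x).
Proof.
by move=> /dot_gt0 a0; rewrite /coroot pmulr_lge0 ?invr_gt0 // pmulr_rge0 ?ltr0n.
Qed.

Lemma refl_self a : a != 0 -> refl dp a a = - a.
Proof. by move=> a0; rewrite reflEc corootaa // scaler_nat mulr2n opprD addrA subrr sub0r. Qed.

Lemma dot_refl a x y : a != 0 -> dp (refl dp a x) (refl dp a y) = dp x y.
Proof.
move=> a0; rewrite !reflEc linearBl !linearBr !linearZl_LR !linearZr_LR /=.
rewrite /coroot (dotC x a); have := lt0r_neq0 (dot_gt0 a0) => d0.
by field.
Qed.

Lemma weyl_dot w x y : dp (w x) (w y) = dp x y.
Proof.
have [s sP ->] := weylP w; elim: s sP x y => [|a s IH] sP x y /=.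
  by rewrite !id_lfunE.
rewrite !comp_lfunE dot_refl ?IH //; last by apply/root_neq0/sP; rewrite mem_head.
by move=> b bs; apply: sP; rewrite inE bs orbT.
Qed.

Lemma refl_root a b : a \in roots D -> b \in roots D -> refl dp a b \in roots D.
Proof. by move=> aR bR; rewrite lfunE; have [_ _ _ /(_ a b aR bR)] := rootsP D. Qed.

Lemma weyl_root w a : a \in roots D -> w a \in roots D.
Proof.
move=> aR; have [s sP ->] := weylP w; elim: s sP => [|b s IH] sP /=.
  by rewrite id_lfunE.
rewrite comp_lfunE; apply: refl_root; first by rewrite sP ?mem_head.
by apply: IH => c cs; rewrite sP // inE cs orbT.
Qed.

Lemma rootN a : a \in roots D -> - a \in roots D.
Proof. by move=> aR; rewrite -(refl_self (root_neq0 aR)) refl_root. Qed.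

Lemma corootN a x : coroot (- a) x = - coroot a x.
Proof. by rewrite /coroot linearNl linearNr linearNl /= opprK mulrN mulNr. Qed.

Lemma reflN a : refl dp (- a) = refl dp a.
Proof. by apply/lfunP => x; rewrite !reflEc corootN scalerN scaleNr opprK. Qed.

Lemma weylZ w c x : w (c *: x) = c *: w x.
Proof. exact: linearZ. Qed.

Lemma weylB w x y : w (x - y) = w x - w y.
Proof. exact: linearB. Qed.

Lemma weylN w x : w (- x) = - w x.
Proof. exact: linearN. Qed.

Lemma weyl1E x : (1%g : weyl D) x = x.
Proof. exact: id_lfunE. Qed.

Lemma weylME w w' x : (w * w')%g x = w (w' x).
Proof. exact: comp_lfunE. Qed.

Lemma weylK w x : (w^-1)%g (w x) = x.
Proof. by rewrite -weylME mulVg weyl1E. Qed.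

Lemma weylKV w x : w ((w^-1)%g x) = x.
Proof. by rewrite -weylME mulgV weyl1E. Qed.

Lemma weyl_inj w : injective w.
Proof. by move=> x y e; rewrite -(weylK w x) e weylK. Qed.

Lemma weyl_eqP w w' : (forall x, w x = w' x) -> w = w'.
Proof. by move=> e; apply: val_inj; apply/lfunP. Qed.

Lemma weyl_invol w : (w * w = 1)%g -> (w^-1 = w)%g.
Proof. by move=> h; rewrite -[LHS]mulg1 -h mulKg. Qed.

Lemma weyl_reflEc a x : a \in roots D -> weyl_refl D a x = x - coroot a x *: a.
Proof. by move=> aR; rewrite weyl_reflE // reflEc. Qed.

Lemma weyl_refl_self a : a \in roots D -> weyl_refl D a a = - a.
Proof. by move=> aR; rewrite weyl_reflE // refl_self // (root_neq0 aR). Qed.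

Lemma weyl_reflN a : a \in roots D -> weyl_refl D (- a) = weyl_refl D a.
Proof. by move=> aR; apply: val_inj; rewrite /= !weyl_reflE ?rootN // reflN. Qed.

Lemma weyl_refl_inv a : a \in roots D -> ((weyl_refl D a)^-1 = weyl_refl D a)%g.
Proof.
move=> aR; apply/weyl_invol/weyl_eqP => x.
by rewrite weylME weyl1E weyl_reflE // -comp_lfunE reflK ?id_lfunE // (root_neq0 aR).
Qed.

Lemma coroot_weyl w a x : coroot (w a) (w x) = coroot a x.
Proof. by rewrite /coroot !weyl_dot. Qed.

Lemma weyl_refl_conj w a : a \in roots D ->
  weyl_refl D (w a) = (w * weyl_refl D a * w^-1)%g.
Proof.
move=> aR; apply: weyl_eqP => x; rewrite !weylME !weyl_reflEc ?weyl_root //.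
by rewrite weylB weylZ weylKV -(coroot_weyl w a) weylKV.
Qed.

Lemma pos_root a : a \in pos D -> a \in roots D.
Proof. by have [_ [v _ ->]] := posP D; case/andP. Qed.

Lemma simple_pos a : a \in simple D -> a \in pos D.
Proof. by have [sub _ _] := simpleP D; apply: sub. Qed.

Lemma pos_heightP : exists v : V, forall a, a \in roots D ->
  (a \in pos D) = (0 < dp v a) /\ dp v a != 0.
Proof.
have [_ [v vn0 e]] := posP D; exists v => a aR; split; last exact: vn0.
by rewrite e inE aR.
Qed.

Lemma posN a : a \in roots D -> (- a \in pos D) = (a \notin pos D).
Proof.
move=> aR; have [v vP] := pos_heightP.
have [-> _] := vP _ (rootN aR); have [-> a0] := vP _ aR.
by rewrite linearNr oppr_gt0 -leNgt le_eqVlt (negPf a0).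
Qed.

Lemma pos_scale a c : a \in pos D -> c *: a \in pos D -> c = 1.
Proof.
move=> aP caP; have aR := pos_root aP.
have [_ _ _ _ /(_ a aR c (pos_root caP))[//|c1]] := rootsP D.
by move: caP; rewrite c1 scaleN1r posN // aP.
Qed.

(** If the reflected root were negative, the nonnegative expansions of [b] and of [- refl dp a b]
    would add up to a multiple of [a]. Independence of the simple roots kills every other
    coefficient of [b], and reducedness leaves [b = a]. *)
Lemma refl_simple_pos a b : a \in simple D -> b \in pos D -> b != a ->
  refl dp a b \in pos D.
Proof.
move=> aS bP bna; apply: contraT => nP.
have aR := simple_roots aS; have bR := pos_root bP.
have mP : - refl dp a b \in pos D by rewrite posN // refl_root.
have [_ fS pS] := simpleP D.
have uS := free_uniq fS.
have [c c0 bE] := pS b bP; have [e e0 bE'] := pS _ mP.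
have dec : \sum_(d <- simple D) (c d + e d) *: d = coroot a b *: a.
  under eq_bigr do rewrite scalerDl.
  by rewrite big_split /= -bE -bE' reflEc opprB addrCA subrr addr0.
have cz d : d \in simple D -> d != a -> c d = 0.
  move=> dS dna; pose g d := c d + e d - coroot a b *+ (d == a).
  have g0 : \sum_(d <- simple D) g d *: d = 0.
    under eq_bigr do rewrite scalerBl.
    rewrite sumrB dec (bigD1_seq a) //= eqxx big1 ?addr0 ?subrr // => d' /negPf ->.
    by rewrite mulr0n scale0r.
  have := free_coef fS g0 dS; rewrite /g (negPf dna) mulr0n subr0.
  by have := c0 d; have := e0 d; lra.
have bca : b = c a *: a.
  rewrite bE (bigD1_seq a) //= big_seq_cond big1 ?addr0 // => d /andP[dS dna].
  by rewrite cz // scale0r.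
have c1 : c a = 1 by apply: (pos_scale (simple_pos aS)); rewrite -bca.
by rewrite bca c1 scale1r eqxx in bna.
Qed.

(** Descent on the height: a positive root that is not simple has positive product with some simple
    [a], and reflecting in [a] keeps it positive and lowers it. *)
Lemma simple_conj b : b \in pos D ->
  exists s a, [/\ {subset s <= simple D}, a \in simple D & b = refl_prod dp s a].
Proof.
have [v vP] := pos_heightP.
(* The height is negated because the induction principle assumes the claim at larger values. *)
pose f b := - dp v b.
move: b; apply: (seq_gt_ind (f := f)) => b bP IH.
have [bS|bnS] := boolP (b \in simple D).
  by exists [::], b; split=> //=; rewrite id_lfunE.
have [_ _ pS] := simpleP D; have [c c0 bE] := pS b bP.
(* Otherwise expanding one factor of [dp b b] in simple roots would give [dp b b <= 0]. *)
have [a aS ab] : exists2 a, a \in simple D & 0 < dp a b.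
  apply: contrapT => no.
  have : 0 < dp b b by rewrite dot_gt0 // (root_neq0 (pos_root bP)).
  rewrite {1}bE linear_sumlz ltNge => /negP; apply; rewrite big_seq.
  apply: sumr_le0 => a aS; rewrite linearZl_LR /=.
  have : dp a b <= 0 by rewrite leNgt; apply/negP => ab; apply: no; exists a.
  by have := c0 a; rewrite /=; nra.
have aR := simple_roots aS; have a0 := root_neq0 aR.
have bna : b != a by apply: contraNneq bnS => ->.
have sP := refl_simple_pos aS bP bna.
have av : 0 < dp v a by have [<- _] := vP _ aR; rewrite simple_pos.
have lt : f b < f (refl dp a b).
  rewrite /f ltrN2 reflEc linearBr linearZr_LR /= ltrBlDr ltrDl.
  by rewrite mulr_gt0 // coroot_gt0.
have [s [d [sS dS e]]] := IH _ sP lt.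
exists (a :: s), d; split=> //=.
  by move=> x; rewrite inE => /orP[/eqP ->|/sS].
by rewrite comp_lfunE -e -comp_lfunE reflK // id_lfunE.
Qed.

Lemma refl_prod_weyl s : {subset s <= simple D} ->
  exists w : weyl D, w = refl_prod dp s :> 'End(V).
Proof.
move=> sS; have sP : `[< in_weyl dp (roots D) (refl_prod dp s) >].
  by apply/asboolP; exists s => // a /sS/simple_roots.
by exists (Weyl sP).
Qed.

(** Membership in W allows words in all roots. Up to sign every root is [u a] with [a] simple and
    [u] a word in simple roots, and its reflection is [u s_a u^-1]. *)
Lemma weyl_word w :
  exists2 s, {subset s <= simple D} & w = refl_prod dp s :> 'End(V).
Proof.
have [s sR] := weylP w; case: w => w wP /= e; rewrite {w wP}e.
elim: s sR => [|b s IH] sR; first by exists [::].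
have bR : b \in roots D by rewrite sR ?mem_head.
have [|s' s'S /= ->] := IH; first by move=> a as'; rewrite sR // inE as' orbT.
suff [t tS ->] : exists2 t, {subset t <= simple D} & refl dp b = refl_prod dp t.
  exists (t ++ s'); last by rewrite refl_prod_cat.
  by move=> a; rewrite mem_cat => /orP[/tS|/s'S].
have {sR IH} : exists2 b', b' \in pos D & refl dp b = refl dp b'.
  have [bP|bnP] := boolP (b \in pos D); first by exists b.
  by exists (- b); rewrite ?reflN // posN.
case=> b' bP ->; have {b bR} [u [a [uS aS e]]] := simple_conj bP.
have aR := simple_roots aS.
have [x xE] := refl_prod_weyl uS.
exists (u ++ a :: rev u).
  move=> d; rewrite mem_cat inE mem_rev => /or3P[/uS|/eqP ->|/uS] //.
have u0 : 0 \notin rev u.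
  by rewrite mem_rev; apply/negP => /uS/simple_roots/root_neq0; rewrite eqxx.
have ub : b' = x a by rewrite xE.
have bR' := pos_root bP.
apply/lfunP => y; rewrite refl_prod_cat /= !comp_lfunE -xE -(weyl_reflE aR).
have /lfunP/(_ y) := refl_prod_rev dp u0; rewrite revK -xE comp_lfunE id_lfunE => e1.
rewrite -(weyl_reflE bR') ub weyl_refl_conj // !weylME.
by rewrite -{1}e1 weylK.
Qed.

Lemma weyl_ind (P : weyl D -> Prop) : P 1%g ->
  (forall a w, a \in simple D -> P w -> P (weyl_refl D a * w)%g) ->
  forall w, P w.
Proof.
move=> P1 PM w; have [s sS] := weyl_word w.
elim: s sS w => [|a s IH] sS w wE; first by rewrite (_ : w = 1%g) //; apply: val_inj.
have aS : a \in simple D by rewrite sS ?mem_head.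
have sS' : {subset s <= simple D} by move=> b bs; rewrite sS // inE bs orbT.
have [w' w'E] := refl_prod_weyl sS'.
have -> : w = (weyl_refl D a * w')%g.
  by apply: val_inj; rewrite /= wE /= w'E weyl_reflE // simple_roots.
by apply: PM => //; apply: IH.
Qed.

(** The exchange condition. Reading the word from the right, some letter [b] first makes a positive
    root [u a] negative. A simple reflection does this to its own root only, so [u a = b], and
    [s_b u s_a = u] drops the letter [b]. *)
Lemma exchange s a w : {subset s <= simple D} -> a \in simple D ->
  w = refl_prod dp s :> 'End(V) -> w a \notin pos D ->
  exists s', [/\ {subset s' <= simple D}, (size s = (size s').+1)%N
    & weyl_val (w * weyl_refl D a)%g = refl_prod dp s'].
Proof.
move=> + aS; elim: s w => [|b s IH] w sS wE.
  by rewrite wE id_lfunE simple_pos.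
have bS : b \in simple D by rewrite sS ?mem_head.
have bR := simple_roots bS; have aR := simple_roots aS.
have sS' : {subset s <= simple D} by move=> d ds; rewrite sS // inE ds orbT.
have [u uE] := refl_prod_weyl sS'.
have wE' : w = (weyl_refl D b * u)%g.
  by apply: val_inj; rewrite /= wE /= uE weyl_reflE.
have [uaP|uanP] := boolP (u a \in pos D); last first.
  have [s' [s'S ss' e]] := IH u sS' uE uanP => _.
  exists (b :: s'); split; first by move=> d; rewrite inE => /orP[/eqP ->|/s'S].
    by rewrite /= ss'.
  have -> : (w * weyl_refl D a = weyl_refl D b * (u * weyl_refl D a))%g by rewrite wE' mulgA.
  by rewrite /= -e -weyl_reflE.
rewrite wE' weylME weyl_reflE // => nP.
have uab : u a = b by apply/eqP; apply: contraNT nP; apply: refl_simple_pos.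
exists s; split=> //; rewrite -uE; congr weyl_val.
by rewrite -uab weyl_refl_conj // -!mulgA mulKg -{1}(weyl_refl_inv aR) mulVg mulg1.
Qed.

(** Write a shortest word for [w] as [u] followed by a last letter [a]. Then [u a = - w a] is
    negative, and exchange yields a shorter word for [w]. *)
Lemma weyl_pos_id w : (forall a, a \in simple D -> w a \in pos D) -> w = 1%g.
Proof.
move=> wP; have [s0 s0S s0E] := weyl_word w.
pose Q n := `[< exists s, [/\ {subset s <= simple D}, size s = n
  & w = refl_prod dp s :> 'End(V)] >].
have exQ : exists n, Q n by exists (size s0); apply/asboolP; exists s0.
case: (ex_minnP exQ) => n /asboolP[s [sS sn sE]] nmin.
case: (lastP s) sS sn sE => [|r a] sS sn sE; first exact: val_inj.
have aS : a \in simple D by rewrite sS // mem_rcons mem_head.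
have aR := simple_roots aS.
have rS : {subset r <= simple D}.
  by move=> b br; rewrite sS // mem_rcons inE br orbT.
have [u uE] := refl_prod_weyl rS.
have wE : w = (u * weyl_refl D a)%g.
  apply: val_inj; rewrite /= sE -cats1 refl_prod_cat /= comp_lfun1r uE.
  by rewrite weyl_reflE.
have uan : u a \notin pos D.
  have := wP a aS; rewrite wE weylME weyl_refl_self // weylN posN //.
  exact: weyl_root.
have [s' [s'S ss' s'E]] := exchange rS aS uE uan.
have : Q (size s') by apply/asboolP; exists s'; rewrite wE.
move=> /nmin; rewrite -sn size_rcons ss' => h; exfalso.
by have := leq_trans (leqnSn _) h; rewrite ltnn.
Qed.

(** If the image of [a] were positive, appending [a] to the longest reduced word would leave it
    reduced: any word for the new product sends [a] to a negative root, so by exchange it has one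
    letter more than some word for the longest element. *)
Lemma longest_simple a : a \in simple D -> longest D a \notin pos D.
Proof.
move=> aS; have aR := simple_roots aS.
have [s [[sS sred] sE] smax] := longestP D.
apply/negP => waP.
pose w := weyl_longest D.
suff red : reduced_word dp (simple D) (rcons s a).
  by have := smax _ red; rewrite size_rcons ltnn.
have raS : {subset rcons s a <= simple D}.
  by move=> b; rewrite mem_rcons inE => /orP[/eqP ->|/sS].
split=> // s' s'S s'E; rewrite size_rcons.
have [u uE] := refl_prod_weyl s'S.
have uE' : u = (w * weyl_refl D a)%g.
  apply: val_inj; rewrite /= uE s'E -cats1 refl_prod_cat /= comp_lfun1r -sE.
  by rewrite weyl_reflE.
have uan : u a \notin pos D.
  rewrite uE' weylME weyl_refl_self // weylN posN ?negbK //.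
  exact: (@weyl_root w).
have [t [tS -> tE]] := exchange s'S aS uE uan.
rewrite ltnS; apply: sred => //; rewrite -tE -sE uE' -mulgA.
by rewrite -{1}(weyl_refl_inv aR) mulVg mulg1.
Qed.

Lemma longest_pos a : a \in pos D -> longest D a \notin pos D.
Proof.
move=> aP; have [v vP] := pos_heightP; have aR := pos_root aP.
have wR b : b \in roots D -> longest D b \in roots D by apply: (@weyl_root (weyl_longest D)).
have [-> _] := vP _ (wR _ aR); rewrite -leNgt.
have [_ _ pS] := simpleP D; have [c c0 ->] := pS a aP.
rewrite !linear_sum big_seq; apply: sumr_le0 => b bS.
rewrite /= linearZ linearZr_LR mulr_ge0_le0 //; first exact: c0.
have [e _] := vP _ (wR _ (simple_roots bS)).
by move: (longest_simple bS); rewrite e -leNgt; apply.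
Qed.

Lemma longest_neg a : a \in roots D -> (longest D a \in pos D) = (a \notin pos D).
Proof.
move=> aR; have [aP|anP] := boolP (a \in pos D); first exact/negbTE/longest_pos.
have := longest_pos (a := - a); rewrite posN // anP linearN /= => /(_ isT).
by rewrite posN ?negbK // (@weyl_root (weyl_longest D)).
Qed.

(** The square of w_0 sends simple roots to positive roots, hence is 1. *)
Lemma weyl_longest_inv : ((weyl_longest D)^-1 = weyl_longest D)%g.
Proof.
apply/weyl_invol/weyl_pos_id => a aS.
have aR := simple_roots aS.
rewrite weylME longest_neg ?longest_simple //.
exact: (@weyl_root (weyl_longest D)).
Qed.

Lemma weyl_longest_sq : (weyl_longest D * weyl_longest D = 1)%g.
Proof. by rewrite -{1}weyl_longest_inv mulVg. Qed.

Lemma weyl_refl_sq a : a \in roots D -> (weyl_refl D a * weyl_refl D a = 1)%g.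
Proof. by move=> aR; rewrite -{1}(weyl_refl_inv aR) mulVg. Qed.

Lemma span_roots_eq x y : (forall a, a \in roots D -> dp a x = dp a y) -> x = y.
Proof.
move=> e; apply/eqP; rewrite -subr_eq0; apply: contraT => /dot_gt0.
set z := x - y.
have [_ _ sp _ _] := rootsP D.
have zS : z \in <<in_tuple (roots D)>>%VS by rewrite sp memvf.
rewrite {1}(coord_span zS) linear_sumlz big1 ?ltxx // => i _.
rewrite linearZl_LR /= linearBr /= e ?subrr ?mulr0 //.
by rewrite mem_nth.
Qed.

(** W acts faithfully on the finite set of roots, because the roots span V. *)
Lemma weyl_finite : exists2 ws : seq (weyl D), uniq ws & forall w, w \in ws.
Proof.
have inR (w : weyl D) (i : seq_sub (roots D)) : w (val i) \in roots D.
  exact: weyl_root (valP i).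
pose F (w : weyl D) : {ffun seq_sub (roots D) -> seq_sub (roots D)} :=
  [ffun i => SeqSub (inR w i)].
have Finj : injective F.
  move=> w w' e; apply: weyl_eqP => x.
  apply: span_roots_eq => a aR.
  have /(congr1 val) := (proj2 (ffunP _ _) e) (SeqSub (weyl_root (w^-1)%g aR)).
  rewrite !ffunE /= weylKV => e1.
  by rewrite [in RHS]e1 weyl_dot -{1}(weylKV w a) weyl_dot.
(* A left inverse of the embedding [F] into a finite type; off the image of [F] it takes the default
   value 1. *)
pose G (f : {ffun seq_sub (roots D) -> seq_sub (roots D)}) :=
  if pselect (exists w, F w = f) is left h then sval (cid h) else 1%g.
have FK : cancel F G.
  move=> w; rewrite /G; case: pselect => [h|[]]; last by exists w.
  by case: cid => w' /= /Finj.
exists (undup [seq G f | f : {ffun _ -> _}]); first exact: undup_uniq.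
by move=> w; rewrite mem_undup -(FK w) image_f.
Qed.

End Roots.

Local Open Scope complex_scope.

(** * The elements p_omega *)

Section PImage.
Variables (R : realType) (V : vectType R) (D : hecke_datum V).
Implicit Types (a b x y v : V) (w : weyl D).

(** [param] carries meaning on positive roots only; the even extension to all roots is invariant
    under all of W. *)
Definition root_param a : R := param D (if a \in pos D then a else - a).

Lemma root_param_pos a : a \in pos D -> root_param a = param D a.
Proof. by rewrite /root_param => ->. Qed.

Lemma root_paramN a : a \in roots D -> root_param (- a) = root_param a.
Proof. by move=> aR; rewrite /root_param posN // opprK; case: (a \in pos D). Qed.

(** The invariance of [param] compares positive roots only. When [u b] is negative, [u s_b] sends
    [b] to the positive root [- u b] instead. *)
Lemma root_param_weyl w a : a \in roots D -> root_param (w a) = root_param a.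
Proof.
have pP b (u : weyl D) : b \in pos D -> root_param (u b) = root_param b.
  move=> bP; have bR := pos_root bP; rewrite /root_param bP.
  case: ifPn => ubP; first exact: (paramP (weylP u) bP ubP).
  have e : - u b = (u * weyl_refl D b)%g b by rewrite weylME weyl_refl_self // weylN.
  have mP : (u * weyl_refl D b)%g b \in pos D by rewrite -e posN // weyl_root.
  by rewrite e; apply: (paramP (weylP _) bP mP).
move=> aR; have [aP|anP] := boolP (a \in pos D); first exact: pP.
by rewrite -root_paramN ?weyl_root // -weylN pP ?posN // root_paramN.
Qed.

(** Up to sign [w] permutes the positive roots; the map [h] is this permutation. *)
Lemma sum_pos_weyl (M : zmodType) (F : V -> M) w :
  {in roots D, forall a, F (- a) = - F a} ->
  \sum_(a <- pos D) F (w a) =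
  \sum_(a <- pos D) (if (w^-1)%g a \in pos D then F a else - F a).
Proof.
move=> Fodd; pose h a := if w a \in pos D then w a else - w a.
have [uP _] := posP D.
have hP a : a \in pos D -> h a \in pos D.
  move=> aP; rewrite /h; case: ifPn => // nP.
  by rewrite posN // weyl_root // pos_root.
have hinj : {in pos D &, injective h}.
  move=> a b aP bP; rewrite /h.
  case: ifPn => _; case: ifPn => _; rewrite -?weylN => /weyl_inj e //.
  - by move: aP; rewrite e posN ?bP // pos_root.
  - by move: bP; rewrite -e posN ?aP // pos_root.
  - exact: oppr_inj.
have perm : perm_eq (pos D) (map h (pos D)).
  have um : uniq (map h (pos D)) by rewrite map_inj_in_uniq.
  have sub : {subset map h (pos D) <= pos D} by move=> _ /mapP[a aP ->]; apply: hP.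
  rewrite perm_sym; apply: uniq_perm => //.
  by have [] := uniq_min_size um sub; rewrite ?size_map.
rewrite [RHS](perm_big _ perm) big_map big_seq [RHS]big_seq.
apply: eq_bigr => a aP; have aR := pos_root aP; rewrite /h.
have [waP|waP] := boolP (w a \in pos D); first by rewrite weylK aP.
by rewrite weylN weylK posN // aP /= Fodd ?opprK // weyl_root.
Qed.

Lemma coroot_refl a x : a \in roots D ->
  coroot D a (weyl_refl D a x) = - coroot D a x.
Proof.
by move=> aR; rewrite -[in RHS](coroot_weyl (weyl_refl D a)) weyl_refl_self // corootN opprK.
Qed.

Lemma coroot_pairing_real a v : coroot_pairing D a (of_real v) = (coroot D a v)%:C.
Proof.
rewrite /coroot_pairing /coroot /of_real /= linear0r -fmorphV.
apply/eqP; rewrite eq_complex /= !(mulr0, mul0r, addr0, subr0).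
by rewrite -[1 + 1]/2%:R !eqxx.
Qed.

Section Module.
Variable M : lmodType R[i].
Implicit Type T : weyl D -> M.

Lemma p_imageE T v : p_image T v =
  2^-1 *: \sum_(a <- pos D) (root_param a * coroot D a v)%:C *: T (weyl_refl D a).
Proof.
rewrite /p_image; congr (_ *: _); rewrite big_seq [RHS]big_seq.
apply: eq_bigr => a aP; congr (_ *: _).
by rewrite root_param_pos // coroot_pairing_real [in RHS]rmorphM.
Qed.

Lemma p_image_linear T c x y :
  p_image T (c *: x + y) = c%:C *: p_image T x + p_image T y.
Proof.
rewrite !p_imageE !scaler_sumr -big_split /=; apply: eq_bigr => a _.
rewrite !scalerA -scalerDl linearP /=; congr (_ *: _).
by rewrite !(rmorphM, rmorphD) /=; ring.
Qed.

(** Conjugation by [w] turns [s_a] into [s_(w a)]. Rewriting the result as a sum over positive roots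
    flips the sign of the terms with [w^-1 b] negative; a flip changes a term by twice its value,
    which absorbs the factor 1/2. *)
Lemma p_image_conj T w v : p_image (fun u => T (w * u * w^-1)%g) v =
  p_image T (w v) - \sum_(b <- pos D | (w^-1)%g b \notin pos D)
    (root_param b * coroot D b (w v))%:C *: T (weyl_refl D b).
Proof.
pose g b := (root_param b * coroot D b (w v))%:C *: T (weyl_refl D b).
have godd : {in roots D, forall b, g (- b) = - g b}.
  move=> b bR; rewrite /g root_paramN // weyl_reflN // corootN mulrN rmorphN.
  by rewrite scaleNr.
rewrite !p_imageE -/g.
have -> : \sum_(a <- pos D) (root_param a * coroot D a v)%:C *:
    T (w * weyl_refl D a * w^-1)%g = \sum_(a <- pos D) g (w a).
  rewrite big_seq [RHS]big_seq; apply: eq_bigr => a /pos_root aR.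
  by rewrite /g root_param_weyl // coroot_weyl weyl_refl_conj.
rewrite (sum_pos_weyl w godd) [X in _ - X]big_mkcond /=.
rewrite (eq_bigr (fun b => g b - (2 : R[i]) *: (if (w^-1)%g b \notin pos D then g b else 0))).
  by rewrite sumrB -scaler_sumr scalerBr scalerA mulVf ?scale1r // pnatr_eq0.
move=> b _; case: ((w^-1)%g b \in pos D) => /=; first by rewrite scaler0 subr0.
by rewrite scaler_nat mulr2n opprD addrA subrr sub0r.
Qed.

(** A simple reflection makes only its own positive root negative, so a single correction term
    survives. *)
Lemma p_image_conj_simple T a v : a \in simple D ->
  p_image (fun u => T (weyl_refl D a * u * weyl_refl D a)%g) v =
  p_image T (weyl_refl D a v) + (param D a * coroot D a v)%:C *: T (weyl_refl D a).
Proof.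
move=> aS; have aP := simple_pos aS; have aR := pos_root aP.
have := p_image_conj T (weyl_refl D a) v; rewrite weyl_refl_inv // => ->.
congr (_ + _); have [uP _] := posP D.
rewrite big_mkcond (bigD1_seq a) //= weyl_refl_self // posN // aP /=.
rewrite big1_seq ?addr0 => [|b /andP[ba bP]]; last first.
  by rewrite weyl_reflE // refl_simple_pos.
by rewrite -scaleNr -rmorphN root_param_pos // coroot_refl // mulrN opprK.
Qed.

(** The longest element makes every positive root negative, so the correction is twice
    [p_image T (longest D v)]. *)
Lemma p_image_conj_longest T v :
  p_image (fun u => T (weyl_longest D * u * weyl_longest D)%g) v =
  - p_image T (longest D v).
Proof.
have := p_image_conj T (weyl_longest D) v; rewrite weyl_longest_inv => ->.
rewrite (_ : \sum_(_ <- _ | _) _ = 2 *: p_image T (longest D v)).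
  by rewrite scaler_nat mulr2n opprD addrA subrr sub0r.
rewrite p_imageE scalerA mulfV ?pnatr_eq0 // scale1r big_seq_cond [RHS]big_seq.
by apply: eq_big => // b; case: (boolP (b \in pos D)) => //= /longest_pos.
Qed.

Lemma p_image_ext T T' v : (forall a, a \in roots D -> T (weyl_refl D a) = T' (weyl_refl D a)) ->
  p_image T v = p_image T' v.
Proof.
move=> e; rewrite /p_image; congr (_ *: _); rewrite big_seq [RHS]big_seq.
by apply: eq_bigr => a /pos_root /e ->.
Qed.

Lemma p_image_map (M' : lmodType R[i]) (f : M -> M') T v :
  (forall c (x y : M), f (c *: x + y) = c *: f x + f y) ->
  f (p_image T v) = p_image (fun w => f (T w)) v.
Proof.
move=> fl; have f0 : f 0 = 0 by rewrite -(addNr (0 : M)) -scaleN1r fl scaleN1r addNr.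
have fZ c (z : M) : f (c *: z) = c *: f z by rewrite -[c *: z]addr0 fl f0 addr0.
have fD (y z : M) : f (y + z) = f y + f z by rewrite -[y]scale1r fl !scale1r.
rewrite /p_image fZ; congr (_ *: _).
by elim/big_rec2: _ => // a x y _ <-; rewrite fD fZ.
Qed.

End Module.

(** * The cross relation for arbitrary elements of W *)

Section Algebra.
Variables (A : algType R[i]) (T : weyl D -> A) (Y : V -> A).
Hypothesis T1 : T 1%g = 1.
Hypothesis TM : forall w w', T (w * w')%g = T w * T w'.
Hypothesis YT : forall a x, a \in simple D ->
  Y x * T (weyl_refl D a) = T (weyl_refl D a) * Y (weyl_refl D a x)
    + (param D a * coroot D a x)%:C%:A.

Lemma p_image_intertwine w v : T w * p_image T v =
  p_image (fun u => T (w * u * w^-1)%g) v * T w.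
Proof.
rewrite (p_image_map (f := fun z : A => T w * z)); last first.
  by move=> c x y; rewrite mulrDr scalerAr.
rewrite (p_image_map (f := fun z : A => z * T w)); last first.
  by move=> c x y; rewrite mulrDl scalerAl.
by apply: p_image_ext => a _; rewrite -!TM -[in RHS]mulgA mulVg mulg1.
Qed.

(** By induction on words only a simple reflection matters; there the scalar of the cross relation
    cancels the correction term of [p_image_conj_simple]. *)
Lemma reduced_intertwine w x :
  T w * (Y x - p_image T x) = (Y (w x) - p_image T (w x)) * T w.
Proof.
elim/weyl_ind: w x => [|a w aS IH] x; first by rewrite T1 mul1r mulr1 weyl1E.
have aR := simple_roots aS.
rewrite TM -mulrA IH mulrA weylME; set y := w x; rewrite mulrA; congr (_ * _).
have e := YT (weyl_refl D a y) aS.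
have ss : T (weyl_refl D a) * T (weyl_refl D a) = 1.
  by rewrite -TM -{1}(weyl_refl_inv aR) mulVg T1.
have sK : weyl_refl D a (weyl_refl D a y) = y by rewrite -{1}(weyl_refl_inv aR) weylK.
rewrite mulrBl e sK mulrBr.
rewrite p_image_intertwine weyl_refl_inv // p_image_conj_simple // mulrDl.
rewrite -(scalerAl _ (T _)) ss coroot_refl // mulrN rmorphN scaleNr opprD.
by rewrite -!addrA; congr (_ + _); rewrite addrC.
Qed.

Lemma T_mulVr w : T (w^-1)%g * T w = 1. Proof. by rewrite -TM mulVg. Qed.
Lemma T_mulrV w : T w * T (w^-1)%g = 1. Proof. by rewrite -TM mulgV. Qed.

Lemma p_image_intertwineE w x :
  T w * p_image T x = p_image T (w x) * T w + \sum_(c <- pos D | w c \notin pos D)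
     (root_param c * coroot D c x)%:C *: T (w * weyl_refl D c)%g.
Proof.
have e := p_image_conj T (w^-1)%g (w x); rewrite weylK invgK in e.
have e1 := p_image_intertwine (w^-1)%g (w x).
rewrite invgK e in e1.
set S := \sum_(_ <- _ | _) _ in e1 *.
have e2 : T w * (p_image T x - S) = p_image T (w x) * T w.
  by rewrite -[_ - S]mulr1 -(T_mulVr w) (mulrA (_ - _)) -e1 !mulrA T_mulrV mul1r.
rewrite -e2 mulrBr -[LHS](subrK (T w * S)) mulr_sumr; congr (_ + _).
by apply: eq_bigr => c _; rewrite TM scalerAr.
Qed.

(** The reduced part of [Y x] passes [T w] freely, so the correction is the one for [p_image]: a
    term for each positive root that [w] makes negative. *)
Lemma T_mulY w x :
  T w * Y x = Y (w x) * T w + \sum_(c <- pos D | w c \notin pos D)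
     (root_param c * coroot D c x)%:C *: T (w * weyl_refl D c)%g.
Proof.
rewrite -[Y x](subrK (p_image T x)) mulrDr reduced_intertwine p_image_intertwineE.
by rewrite addrA -mulrDl subrK.
Qed.

(** In other words omega^* = - omega + 2 p_omega, which makes the reduced element skew-adjoint once
    p_omega is self-adjoint. *)
Lemma longest_conj x : T (weyl_longest D) * Y (longest D x) * T (weyl_longest D) =
  Y x - p_image T x *+ 2.
Proof.
set w0 := weyl_longest D.
have w0x y : longest D y = w0 y by [].
have w0V : (w0^-1)%g = w0 := weyl_longest_inv D.
have w0K : w0 (w0 x) = x by rewrite -{1}w0V weylK.
have tt : T w0 * T w0 = 1 by rewrite -{1}w0V T_mulVr.
rewrite -[Y (_ x)](subrK (p_image T (w0 x))) mulrDr mulrDl reduced_intertwine w0K.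
rewrite p_image_intertwine w0V p_image_conj_longest w0x w0K.
by rewrite -!mulrA tt !mulr1 mulr2n opprD addrA.
Qed.

End Algebra.
End PImage.

Local Open Scope ring_scope.
Local Open Scope sesquilinear_scope.

(** * One W-type modules in coordinates *)

Section HermitianMatrices.
Variable C : numClosedFieldType.

Lemma trmxCM m n p (A : 'M[C]_(m, n)) (B : 'M[C]_(n, p)) :
  (A *m B)^t* = B^t* *m A^t*.
Proof. by rewrite trmx_mul map_mxM. Qed.

Lemma trmxCZ m n c (A : 'M[C]_(m, n)) : (c *: A)^t* = c^* *: A^t*.
Proof. by apply/matrixP => i j; rewrite !mxE rmorphM. Qed.

Lemma trmxCD m n (A B : 'M[C]_(m, n)) : (A + B)^t* = A^t* + B^t*.
Proof. by apply/matrixP => i j; rewrite !mxE rmorphD. Qed.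

Lemma trmxCN m n (A : 'M[C]_(m, n)) : (- A)^t* = - A^t*.
Proof. by apply/matrixP => i j; rewrite !mxE rmorphN. Qed.

Lemma trmxC_sum m n I (s : seq I) (F : I -> 'M[C]_(m, n)) :
  (\sum_(i <- s) F i)^t* = \sum_(i <- s) (F i)^t*.
Proof.
elim/big_rec2: _ => [|i A B _ <-]; last by rewrite trmxCD.
by apply/matrixP => i j; rewrite !mxE rmorph0.
Qed.

Lemma mxtrace_trmxC n (A : 'M[C]_n) : \tr (A^t*) = (\tr A)^*.
Proof. by rewrite /mxtrace rmorph_sum; apply: eq_bigr => i _; rewrite !mxE. Qed.

Lemma trig_eigenvalue n (A : 'M[C]_n) i : is_trig_mx A -> eigenvalue A (A i i).
Proof.
move=> tA; rewrite eigenvalue_root_char char_poly_trig //.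
by rewrite rootE horner_prod (bigD1 i) //= !hornerE subrr mul0r.
Qed.

(* Simultaneously unitarily triangular: the trace is the sum of the products of
   the diagonal entries, which are imaginary for H and real for A. *)
Lemma skew_trace n (H A : 'M[C]_n) : H *m A = A *m H -> H^t* = - H ->
  (forall c, eigenvalue A c -> c^* = c) -> (\tr (H *m A))^* = - \tr (H *m A).
Proof.
move=> HA Hs Ar; have [P Pu /andP[tH tA]] := cotrigonalization2 HA.
move: tH tA; rewrite /similar_to !conjymx //.
set H' := P *m H *m _; set A' := P *m A *m _ => tH tA.
have PP : P^t* *m P = 1%:M by apply: mulmx1C; apply/unitarymxP.
have -> : \tr (H *m A) = \tr (H' *m A').
  rewrite /H' /A' -!mulmxA (mulmxA _ P) PP mul1mx [RHS]mxtrace_mulC -!mulmxA.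
  by rewrite PP mulmx1.
have H's : H'^t* = - H' by rewrite /H' !trmxCM trmxCK Hs mulNmx mulmxN mulmxA.
have A'r i : (A' i i)^* = A' i i.
  apply: Ar; have /eigenvalueP[v vA v0] := trig_eigenvalue i tA.
  apply/eigenvalueP; exists (v *m P).
    by rewrite scalemxAl -vA /A' -!mulmxA PP mulmx1.
  apply: contraNneq v0 => vP.
  by rewrite -(mulmxtVK v Pu) vP mul0mx.
have -> : \tr (H' *m A') = \sum_i H' i i * A' i i.
  apply: eq_bigr => i _; rewrite mxE (bigD1 i) //= big1 ?addr0 // => j ji.
  have [ij|] := ltnP i j; first by rewrite (is_trig_mxP tH) ?mul0r.
  rewrite leq_eqVlt val_eqE (negPf ji) => lt.
  by rewrite (is_trig_mxP tA) ?mulr0.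
rewrite rmorph_sum -sumrN; apply: eq_bigr => i _.
have e : (H' i i)^* = - H' i i.
  by have /matrixP/(_ i i) := H's; rewrite [LHS]mxE [X in X^*]mxE [RHS]mxE.
by rewrite rmorphM /= A'r e mulNr.
Qed.

End HermitianMatrices.

(** * Summation over W *)

Section WeylSum.
Variables (R : realType) (V : vectType R) (D : hecke_datum V).

Definition weyl_enum : seq (weyl D) := s2val (cid2 (weyl_finite D)).

Lemma weyl_enum_uniq : uniq weyl_enum.
Proof. exact: (s2valP (cid2 (weyl_finite D))). Qed.

Lemma mem_weyl_enum w : w \in weyl_enum.
Proof. exact: (s2valP' (cid2 (weyl_finite D))). Qed.

Lemma sum_weyl_reindex (M : nmodType) (F : weyl D -> M) (h h' : weyl D -> weyl D) :
  cancel h h' -> cancel h' h ->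
  \sum_(w <- weyl_enum) F (h w) = \sum_(w <- weyl_enum) F w.
Proof.
move=> hK h'K; rewrite -(big_map h xpredT F); apply: perm_big.
apply: uniq_perm; rewrite ?weyl_enum_uniq ?(map_inj_uniq (can_inj hK)) ?weyl_enum_uniq //.
by move=> w; rewrite mem_weyl_enum -(h'K w) map_f ?mem_weyl_enum.
Qed.

End WeylSum.

(** * Matrices satisfying the Hecke relations, with unitary [T] *)

Section OneWType.
Variables (R : realType) (V : vectType R) (D : hecke_datum V) (n : nat).
Local Notation C := R[i].
Local Notation Mat := 'M[R[i]]_n.+1.
Implicit Types (a b x y : V) (w : weyl D) (v : 'rV[R[i]]_n.+1).
Variables (T : weyl D -> Mat) (Y : V -> Mat).
Hypothesis T1 : T 1%g = 1.
Hypothesis TM : forall w w', T (w * w')%g = T w * T w'.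
Hypothesis YT : forall a x, a \in simple D ->
  Y x * T (weyl_refl D a) = T (weyl_refl D a) * Y (weyl_refl D a x)
    + (param D a * coroot D a x)%:C%:A.
Hypothesis Yl : forall c x y, Y (c *: x + y) = c%:C *: Y x + Y y.
Hypothesis YC : forall x y, Y x *m Y y = Y y *m Y x.
Hypothesis TU : forall w, T (w^-1)%g = (T w)^t*.
Hypothesis schurT : forall M : Mat, (forall w, M *m T w = T w *m M) ->
  exists c, M = c%:M.
Hypothesis Yadj : forall x,
  (Y x)^t* = - (T (weyl_longest D) * Y (longest D x) * T (weyl_longest D)).

Local Notation P := (p_image T).
Local Notation A := (fun x => Y x - P x).

Lemma TME w w' : T (w * w')%g = T w *m T w'. Proof. exact: TM. Qed.

(** The average commutes with every [T u], so Schur's lemma applies. The orthogonality relations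
    below are instances of it. *)
Lemma schur_average (E : Mat) : exists c,
  \sum_(w <- weyl_enum D) T w *m E *m T (w^-1)%g = c%:M.
Proof.
apply: schurT => u; rewrite mulmx_suml mulmx_sumr.
rewrite -(sum_weyl_reindex _ (mulKg u) (mulVKg u)).
apply: eq_bigr => w _; rewrite invgM !TME -!mulmxA.
by rewrite -(TME (u^-1)%g u) mulVg T1 mulmx1.
Qed.

(** * Imaginary parts of weights *)

Section Weight.
Variables (v : 'rV[R[i]]_n.+1) (l : V -> R[i]).
Hypothesis v0 : v != 0.
Hypothesis vY : forall x, v *m Y x = l x *: v.

Lemma weight_linear c x y : l (c *: x + y) = c%:C * l x + l y.
Proof.
apply/eqP; rewrite -subr_eq0.
have : (l (c *: x + y) - (c%:C * l x + l y)) *: v == 0.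
  by rewrite scalerBl -vY Yl mulmxDr -scalemxAr !vY scalerA -scalerDl subrr.
by rewrite scaler_eq0 (negPf v0) orbF.
Qed.

Lemma weightN x : l (- x) = - l x.
Proof.
have l0 : l 0 = 0.
  have := weight_linear 1 0 0; rewrite scaler0 addr0 mul1r => /eqP.
  by rewrite -subr_eq subrr eq_sym => /eqP.
by rewrite -[- x]addr0 -scaleN1r weight_linear l0 addr0 rmorphN1 mulN1r.
Qed.

Lemma weight_refl a x : a \in roots D ->
  l (weyl_refl D a x) = l x - (coroot D a x)%:C * l a.
Proof.
by move=> aR; rewrite weyl_reflEc // -scaleNr addrC weight_linear rmorphN mulNr addrC.
Qed.

Let nu x : R := complex.Im (l x).

Lemma im_weight_linear c x y : nu (c *: x + y) = c * nu x + nu y.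
Proof.
rewrite /nu weight_linear; case: (l x) (l y) => [a b] [d e] /=.
by rewrite mul0r addr0.
Qed.

Lemma im_weightN x : nu (- x) = - nu x.
Proof. by rewrite /nu weightN; case: (l x). Qed.

Lemma im_weight_refl a x : a \in roots D ->
  nu (weyl_refl D a x) = nu x - coroot D a x * nu a.
Proof.
move=> aR; rewrite /nu weight_refl //; case: (l x) (l a) => [b c] [d e] /=.
by rewrite mul0r addr0.
Qed.

Hypothesis dom : forall a, a \in pos D -> 0 <= nu a.

(* The matrix coefficient w |-> <v t_w, v> is supported on the stabilizer of
   the imaginary part of the weight: the pairing with v t_{w_0} is nonzero
   only on vectors of one weight, and t_w moves weights triangularly. *)
Lemma coef_longest_support w :
  v *m T w *m (v *m T (weyl_longest D))^t* != 0 ->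
  forall x, nu (w x) = nu (longest D x).
Proof.
set w0 := weyl_longest D; set u := v *m T w0.
pose F w := v *m T w *m u^t*; rewrite -/(F w).
have [h hP] := pos_heightP D.
(* [u] is a joint eigenvector of the adjoints of the [Y x], so pairing with [u] turns right
   multiplication by [Y x] into a scalar. *)
have uY x : u *m (Y x)^t* = - l (longest D x) *: u.
  rewrite Yadj mulmxN -!mulmxE -/w0 /u -!mulmxA (mulmxA (T w0) (T w0)) -TME.
  by rewrite weyl_longest_sq T1 mul1mx mulmxA vY -scalemxAl scaleNr.
(* The cross relation [T_mulY] paired with [v] and [u], on both of which [Y] acts by scalars. *)
have rec (u' : weyl D) x : (- (l (longest D x))^* - l (u' x)) *: F u' =
    \sum_(c <- pos D | u' c \notin pos D)
       (root_param D c * coroot D c x)%:C *: F (u' * weyl_refl D c)%g.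
  have : v *m (T u' *m Y x) *m u^t* = - (l (longest D x))^* *: F u'.
    rewrite !mulmxA -(mulmxA (v *m _)) -[Y x]trmxCK -trmxCM uY trmxCZ -scalemxAr.
    by rewrite rmorphN.
  have := T_mulY T1 TM YT u' x; rewrite -[T u' * Y x]/(T u' *m Y x) => ->.
  rewrite mulmxDr mulmxDl -[Y (u' x) * _]/(_ *m _) mulmxA vY -!scalemxAl -/(F u').
  rewrite scalerBl => <-; rewrite addrC addKr mulmx_sumr mulmx_suml.
  by apply: eq_bigr => c _; rewrite -scalemxAr -scalemxAl.
move: w (mem_weyl_enum w).
apply: (seq_gt_ind (f := fun w : weyl D => dotp D h (w h))) => w _ IH Fw x.
apply: contrapT => nx.
(* If [F (w s_c)] were nonzero, the induction hypothesis would apply to [w s_c], whose height is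
   larger. Together with dominance it gives [nu (w c) = 0]; then [w] and [w s_c] have the same
   effect on [nu], and the claim holds for [w] after all. *)
have sum0 : \sum_(c <- pos D | w c \notin pos D)
    (root_param D c * coroot D c x)%:C *: F (w * weyl_refl D c)%g = 0.
  rewrite big_seq_cond big1 // => c /andP[cP wcP].
  have [->|Fc] := eqVneq (F (w * weyl_refl D c)%g) 0; first by rewrite scaler0.
  have cR := pos_root cP; have wcR := weyl_root w cR.
  case: nx.
  have lt : dotp D h (w h) < dotp D h ((w * weyl_refl D c)%g h).
    rewrite weylME weyl_reflEc // weylB weylZ linearBr linearZr_LR /= ltrDl oppr_gt0.
    rewrite pmulr_rlt0; last by rewrite coroot_gt0 ?(root_neq0 cR) // dotC -(hP _ cR).1.
    have [e e0] := hP _ wcR.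
    by rewrite lt_neqAle e0 /= leNgt -e.
  have IHc := IH _ (mem_weyl_enum _) lt Fc.
  have nwc : nu (w c) = 0.
    apply: le_anti; apply/andP; split.
      by rewrite -oppr_ge0 -im_weightN dom // posN.
    have := IHc c; rewrite weylME weyl_refl_self // weylN im_weightN => e.
    rewrite -oppr_le0 e -oppr_ge0 -im_weightN; apply: dom.
    by rewrite posN ?longest_pos // (@weyl_root _ _ _ w0).
  have := IHc x; rewrite weylME weyl_reflEc // weylB weylZ -scaleNr addrC.
  by rewrite im_weight_linear nwc mulr0 add0r.
(* The scalar on the left of [rec] must vanish, and its imaginary part is the difference of the two
   values of [nu]. *)
have := rec w x; rewrite sum0 => /eqP; rewrite scaler_eq0 (negPf Fw) orbF => /eqP e.
apply: nx; move: e; rewrite /nu; case: (l (w x)) (l (longest D x)) => [a b] [c d] /eqP.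
by rewrite eq_complex /= => /andP[_ /eqP]; lra.
Qed.

Let G w := v *m T w *m v^t*.

(** Apply the preceding lemma to [w * w0]: the unitary matrix [T w0] cancels from the
    coefficient. *)
Lemma coef_support w : G w != 0 -> forall x, nu (w x) = nu x.
Proof.
move=> Gw x; pose w0 := weyl_longest D.
have := @coef_longest_support (w * w0)%g.
rewrite TME mulmxA trmxCM -TU !mulmxA -(mulmxA _ (T w0)) -TME mulgV T1 mulmx1.
have w0K : w0 (w0 x) = x by rewrite -weylME weyl_longest_sq weyl1E.
by move=> /(_ Gw (w0 x)); rewrite weylME -[longest D _]/(w0 (w0 x)) w0K.
Qed.

Lemma im_weight_root a : a \in roots D -> nu a = 0.
Proof.
move=> aR; apply: contrapT => /eqP na.
set s := weyl_refl D a.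
have ss : (s * s = 1)%g by apply: weyl_refl_sq.
have sV : (s^-1 = s)%g by apply: weyl_refl_inv.
have Gs : G s = 0.
  apply/eqP; apply: contraT => /coef_support/(_ a).
  rewrite weyl_refl_self // im_weightN => e.
  by case/eqP: na; lra.
have GV w : G (w^-1)%g = (G w)^t* by rewrite /G !trmxCM trmxCK TU mulmxA.
(* For this matrix of rank one the average, placed between [v T s] and [v^*], becomes the sum of the
   products [G (s w s) G (w^-1)], which is therefore a multiple of [G s = 0]. *)
have [k kE] := schur_average ((v *m T s)^t* *m v).
have sum0 : \sum_(w <- weyl_enum D) G (s * w * s)%g *m G (w^-1)%g = 0.
  transitivity (v *m T s *m k%:M *m v^t*); last first.
    by rewrite mul_mx_scalar -scalemxAl -/(G s) Gs scaler0.
  rewrite -kE mulmx_sumr mulmx_suml; apply: eq_bigr => w _.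
  by rewrite /G trmxCM -TU sV !TME !mulmxA.
(* If [w] and [s w s] both fix [nu], then [w] preserves [coroot D a], because [nu a] is nonzero.
   Hence [w a = a] and [w] commutes with [s], so the surviving terms are squared moduli. *)
have comm w : G w != 0 -> G (s * w * s)%g != 0 -> (s * w * s)%g = w.
  move=> /coef_support nw /coef_support nsws.
  suff wa : w a = a.
    have e : s = (w * s * w^-1)%g by rewrite -weyl_refl_conj // wa.
    by rewrite {1}e -!mulgA mulKg ss mulg1.
  have cw z : coroot D a (w z) = coroot D a z.
    have sK y : s (s y) = y by rewrite -weylME ss weyl1E.
    have := nsws (s z); rewrite !weylME sK !im_weight_refl // nw => /addrI/oppr_inj.
    exact: mulIf.
  apply/eqP; rewrite -subr_eq0; apply: contraT => /(dot_gt0 D).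
  set d := w a - a; suff -> : dotp D d d = 0 by rewrite ltxx.
  have a0 := lt0r_neq0 (dot_gt0 D (root_neq0 aR)).
  have := cw ((w^-1)%g d); rewrite weylKV /coroot => /(congr1 ( *%R^~ (dotp D a a))).
  rewrite !divfK // => /(mulfI _) e.
  by rewrite {1}/d linearBl /= e ?pnatr_eq0 // -(weyl_dot w a) weylKV subrr.
have term0 w : 0 <= (G (s * w * s)%g *m G (w^-1)%g) 0 0.
  have [Gw|Gw] := eqVneq (G w) 0.
    by rewrite GV Gw trmx0 map_mx0 mulmx0 mxE.
  have [->|Gsws] := eqVneq (G (s * w * s)%g) 0; first by rewrite mul0mx mxE.
  by rewrite comm // GV mxE big_ord1 !mxE mul_conjC_ge0.
have Gv : 0 < (v *m v^t*) 0 0 by rewrite -dotmxE dotmx_is_dotmx.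
have : (\sum_(w <- weyl_enum D) G (s * w * s)%g *m G (w^-1)%g) 0 0 = 0.
  by rewrite sum0 mxE.
(* The term at 1 is the square of the positive number [v v^*]. *)
rewrite summxE (bigD1_seq 1%g) ?mem_weyl_enum ?weyl_enum_uniq //= => /eqP.
rewrite paddr_eq0 ?term0 ?sumr_ge0 // => /andP[/eqP e _]; move: e.
rewrite mulg1 ss invg1 /G T1 mulmx1 mxE big_ord1 => /eqP.
by rewrite mulf_eq0 orbb (gt_eqF Gv).
Qed.


(** The intertwiner of [s_a] applied to [v] is [v T_s - (k / l a) v]. Were it zero, [T_s^2 = 1]
    would force [l a] to be [k] or [- k], which is real. *)
Lemma weight_reflect a : a \in simple D -> nu a != 0 ->
  exists2 v' : 'rV[R[i]]_n.+1, v' != 0 & forall x, v' *m Y x = l (weyl_refl D a x) *: v'.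
Proof.
move=> aS na; have aR := simple_roots aS; set s := weyl_refl D a.
have la : l a != 0 by apply: contraNneq na; rewrite /nu => ->.
pose k : C := (param D a)%:C; pose e := - (k / l a).
have TT : T s *m T s = 1%:M by rewrite -TME weyl_refl_sq.
have TY x : v *m T s *m Y x = l (s x) *: (v *m T s) + (k * (coroot D a x)%:C) *: v.
  have := YT (s x) aS; rewrite -/s -weylME weyl_refl_sq // weyl1E => /(congr1 (mulmx v)).
  rewrite -[_ * T s]/(_ *m _) -[T s * _]/(_ *m _) mulmxDr !mulmxA vY.
  rewrite -scalemxAl => ->; rewrite coroot_refl // mulrN rmorphN rmorphM scaleNr.
  by rewrite mulmxN -scalemxAr mulmx1 subrK.
exists (v *m T s + e *: v) => [|x].
  apply: contraNneq na => v'0.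
  have vs : v *m T s = - e *: v by apply/eqP; rewrite scaleNr -addr_eq0 v'0.
  have : v = (e ^+ 2) *: v.
    by rewrite -{1}[v]mulmx1 -TT mulmxA vs -scalemxAl vs scalerA mulrNN.
  move=> /eqP; rewrite -subr_eq0 -{1}[v]scale1r -scalerBl scaler_eq0 (negPf v0) orbF.
  rewrite subr_eq0 eq_sym /e sqrrN expr_div_n => /eqP h.
  have : l a ^+ 2 == k ^+ 2 by rewrite -[X in _ == X](divfK (expf_neq0 2 la)) h mul1r.
  by rewrite eqf_sqr /nu => /orP[] /eqP -> /=; rewrite ?oppr0.
rewrite mulmxDl TY -scalemxAl vY scalerDr !scalerA -addrA -scalerDl; congr (_ + _ *: _).
have := weight_refl x aR; rewrite -/s => ->; rewrite /e.
by field.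
Qed.

End Weight.


(** Among the W-translates of the imaginary part that belong to joint eigenvectors, the one with the
    largest value at the regular vector [h] is dominant, since [weight_reflect] would otherwise
    increase this value. It vanishes on roots, and roots span V. *)
Lemma weight_real v (l : V -> R[i]) : v != 0 ->
  (forall x, v *m Y x = l x *: v) -> forall x, complex.Im (l x) = 0.
Proof.
move=> v0 vY.
have [h hP] := pos_heightP D.
pose Q w := exists v' l', [/\ v' != 0, forall x, v' *m Y x = l' x *: v'
  & forall x, complex.Im (l' x) = complex.Im (l (w x))].
have Q1 : Q 1%g by exists v, l; split=> // x; rewrite weyl1E.
have [w [_ [v' [l' [v'0 v'Y l'E]]] wmax]] :=
  exists_seq_max (fun w : weyl D => complex.Im (l (w h))) (mem_weyl_enum 1%g) Q1.
have lin' := im_weight_linear v'0 v'Y.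
have dom a : a \in simple D -> 0 <= complex.Im (l' a).
  move=> aS; rewrite leNgt; apply/negP => neg.
  have aR := simple_roots aS.
  have [u u0 uY] := weight_reflect v'0 v'Y aS (ltr0_neq0 neg).
  have Qs : Q (w * weyl_refl D a)%g.
    exists u, (l' \o weyl_refl D a); split=> // x /=.
    by rewrite l'E weylME.
  have := wmax _ (mem_weyl_enum _) Qs.
  rewrite weylME -!l'E (im_weight_refl v'0 v'Y) // leNgt => /negP; apply.
  by rewrite ltrDl oppr_gt0 pmulr_rlt0 // coroot_gt0 ?(root_neq0 aR) // dotC
    -(hP _ aR).1 simple_pos.
have f0 : complex.Im (l' 0) = 0.
  by have := lin' 1 0 0; rewrite scaler0 addr0 => /eqP; rewrite mul1r -subr_eq subrr => /eqP.
have fsum (I : Type) (s : seq I) (c : I -> R) (u : I -> V) :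
    complex.Im (l' (\sum_(i <- s) c i *: u i)) = \sum_(i <- s) c i * complex.Im (l' (u i)).
  by elim/big_rec2: _ => // i y1 y2 _ <-; rewrite lin'.
have domP a : a \in pos D -> 0 <= complex.Im (l' a).
  have [_ _ pS] := simpleP D => /pS[c c0 ->]; rewrite fsum big_seq.
  by apply: sumr_ge0 => b bS; rewrite mulr_ge0 ?dom.
have l'0 x : complex.Im (l' x) = 0.
  have [_ _ sp _ _] := rootsP D.
  have xS : x \in <<in_tuple (roots D)>>%VS by rewrite sp memvf.
  rewrite (coord_span xS) fsum big1 // => i _.
  by rewrite (im_weight_root v'0 v'Y domP) ?mulr0 // mem_nth.
by move=> x; rewrite -(weylKV w x) -l'E l'0.
Qed.

(** The eigenspace is stable under the commuting family [Y], so it contains a joint eigenvector,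
    whose weight takes the value [c] at [x]. *)
Lemma eigenvalue_real x c : eigenvalue (Y x) c -> c^* = c.
Proof.
move=> xc; pose W := eigenspace (Y x) c.
pose As := [seq Y b | b <- vbasis fullv].
have Wst y : stablemx W (Y y) by apply: comm_mx_stable_eigenspace; apply: YC.
(* Common eigenvectors are available for finite families, so a basis of V replaces V; linearity of
   [Y] recovers the rest. *)
have [||u u0 /allP uP] := @common_eigenvector _ _ [seq restrictmx W B | B <- As].
- by rewrite lt0n mxrank_eq0.
- move=> _ _ /mapP[_ /mapP[y _ ->] ->] /mapP[_ /mapP[z _ ->] ->].
  have Wb t : stablemx (row_base W) (Y t) by rewrite stablemx_row_base Wst.
  have rM t t' : restrictmx W (Y t *m Y t') = restrictmx W (Y t) *m restrictmx W (Y t').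
    by apply: conjmxM; rewrite inE Wb.
  by rewrite /comm_mx -!rM; congr (restrictmx W _); exact: YC.
pose v := u *m row_base W.
have v0 : v != 0 by rewrite mulmx_free_eq0 ?row_base_free.
have vb b : b \in vbasis {:V} -> exists d, v *m Y b = d *: v.
  move=> bb; apply/sub_rVP; rewrite -[(_ <= _)%MS]/(stablemx v (Y b)).
  rewrite -stablemx_restrict //; apply: uP.
  by rewrite -map_comp; apply/mapP; exists b.
have vY y : exists d, v *m Y y = d *: v.
  have Y0 : Y 0 = 0 by have := Yl 1 0 0; rewrite scaler0 addr0 => /eqP;
    rewrite scale1r -subr_eq subrr => /eqP.
  rewrite (coord_vbasis (memvf y)); elim/big_rec: _ => [|i z _ [d dE]].
    by exists 0; rewrite Y0 mulmx0 scale0r.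
  have [e eE] : exists e, v *m Y (vbasis fullv)`_i = e *: v.
    by apply: vb; rewrite mem_nth // size_tuple.
  exists ((coord (vbasis fullv) i y)%:C * e + d).
  by rewrite Yl mulmxDr dE -scalemxAr eE scalerA scalerDl.
have [l lE] := choice vY.
have vc : l x = c.
  apply/eqP; rewrite -subr_eq0; have : (l x - c) *: v == 0.
    rewrite scalerBl -lE subr_eq0; apply/eqP.
    by apply/eigenspaceP; rewrite mulmx_sub // eq_row_base.
  by rewrite scaler_eq0 (negPf v0) orbF.
have := weight_real v0 lE x; rewrite vc; case: (c) => p q /= ->.
by apply/eqP; rewrite eq_complex /= oppr0 !eqxx.
Qed.

(** * Vanishing of the reduced elements *)

Section Reduced.
(* Abstract because unification diverges when it may unfold this term. *)
Variable red : V -> Mat.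
Hypothesis redE : forall x, red x = Y x - P x.


Lemma real_conj (r : R) : ((r%:C)^* = r%:C :> R[i])%R.
Proof. by apply/eqP; rewrite eq_complex /= oppr0 !eqxx. Qed.

Lemma p_image_adj x : (P x)^t* = P x.
Proof.
rewrite p_imageE trmxCZ trmxC_sum fmorphV rmorph_nat; congr (_ *: _).
rewrite big_seq [RHS]big_seq; apply: eq_bigr => a /pos_root aR.
by rewrite trmxCZ real_conj -TU weyl_refl_inv.
Qed.

Lemma red_adj x : (red x)^t* = - red x.
Proof.
rewrite redE trmxCD trmxCN p_image_adj Yadj (longest_conj T1 TM YT) mulr2n.
by rewrite !opprD !opprK addrA addrK.
Qed.

Lemma red_trace_conj (u : weyl D) x w :
  \tr (red (u x) *m T (u * w * u^-1)%g) = \tr (red x *m T w).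
Proof.
have e : T u *m red x = red (u x) *m T u.
  by rewrite !redE; exact: (reduced_intertwine T1 TM YT u x).
rewrite !TME !mulmxA -e.
by rewrite mxtrace_mulC !mulmxA -TME mulVg T1 mul1mx.
Qed.

(** As [w] is orthogonal, the kernel and the image of [w - 1] are orthogonal to each other; by
    dimension they span V. *)
Lemma fixed_decomposition w x : exists x0 y, w x0 = x0 /\ x = x0 + (w y - y).
Proof.
pose f := (weyl_val w - \1)%VF.
have fE z : f z = w z - z by rewrite add_lfunE opp_lfunE id_lfunE.
have cap0 : (lker f :&: limg f)%VS = 0%VS.
  apply/eqP; rewrite -subv0; apply/subvP => z; rewrite memv_cap memv_ker fE subr_eq0.
  move=> /andP[/eqP wz /memv_imgP[y _]]; rewrite fE => zE; rewrite memv0.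
  apply: contraT => /(dot_gt0 D); rewrite {2}zE linearBr /= -{1}wz weyl_dot subrr.
  by rewrite ltxx.
have full : (lker f + limg f)%VS = fullv.
  apply/eqP; rewrite eqEdim subvf /= dimv_disjoint_sum // -[leqLHS](limg_ker_dim f).
  by rewrite capfv.
have := memvf x; rewrite -full => /memv_addP[x0 + [_ /memv_imgP[y _ ->] ->]].
rewrite memv_ker fE subr_eq0 => /eqP wx0.
by exists x0, y; rewrite -fE.
Qed.

(** The translate with the largest product with the regular vector [h] is dominant: a simple
    reflection cannot increase that product. *)
Lemma dominant_conj x : exists w, forall a, a \in pos D -> 0 <= coroot D a (w x).
Proof.
have [h hP] := pos_heightP D.
have [w [_ _ wmax]] := exists_seq_max (fun w : weyl D => dotp D h (w x))
  (mem_weyl_enum 1%g) I (P := fun=> True).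
exists w; set z := w x.
have dom a : a \in simple D -> 0 <= dotp D a z.
  move=> aS; have aR := simple_roots aS; have a0 := root_neq0 aR.
  have := wmax _ (mem_weyl_enum (weyl_refl D a * w)%g) I.
  rewrite weylME weyl_reflEc // linearBr linearZr_LR /= -/z gerBl pmulr_lge0.
    by rewrite coroot_ge0.
  by rewrite -(hP _ aR).1 simple_pos.
move=> a aP; rewrite coroot_ge0 ?(root_neq0 (pos_root aP)) //.
have [_ _ pS] := simpleP D; have [c c0 ->] := pS a aP.
rewrite linear_sumlz big_seq; apply: sumr_ge0 => b bS.
by rewrite linearZl_LR mulr_ge0 ?dom // c0.
Qed.

(** Schur orthogonality: each entry of [M], times a nonzero constant, is a combination of the traces
    of the [M T_w]. *)
Lemma trace_orthogonality (M : Mat) : (forall w, \tr (M *m T w) = 0) -> M = 0.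
Proof.
move=> M0; pose E i j := \sum_(w <- weyl_enum D) T w *m delta_mx i j *m T (w^-1)%g.
have /choice[k kE] : forall ij : 'I_n.+1 * 'I_n.+1, exists c, E ij.1 ij.2 = c%:M.
  by move=> ij; apply: schur_average.
(* Taking traces in the average of an elementary matrix determines its scalar value. *)
have kT i j : k (i, j) *+ n.+1 = (i == j)%:R *+ size (weyl_enum D).
  rewrite -mxtrace_scalar -kE /E /= raddf_sum /=.
  rewrite (eq_bigr (fun=> (i == j)%:R)) ?big_const_seq ?iter_addr_0 ?count_predT //.
  move=> w _; rewrite mxtrace_mulC mulmxA -TME mulVg T1 mul1mx.
  rewrite /mxtrace (bigD1 i) //= mxE eqxx big1 ?addr0 // => p pi.
  by rewrite mxE (negPf pi).
have k0 i j : i != j -> k (i, j) = 0.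
  by move=> ij; apply/eqP; have /eqP := kT i j; rewrite (negPf ij) mul0rn mulrn_eq0.
have k1 j : k (j, j) != 0.
  apply/eqP => kz; have /esym/eqP := kT j j; rewrite kz mul0rn eqxx mulrn_eq0.
  by rewrite oner_eq0 orbF; case: (weyl_enum D) (mem_weyl_enum (1%g : weyl D)).
apply/matrixP => j q; rewrite [RHS]mxE; apply: (mulIf (k1 j)); rewrite mul0r.
transitivity (\sum_(w <- weyl_enum D) \tr (M *m T w) * T (w^-1)%g j q); last first.
  by rewrite big1 // => w _; rewrite M0 mul0r.
have entry w p i : (T w *m delta_mx i j *m T (w^-1)%g) p q = T w p i * T (w^-1)%g j q.
  rewrite !mxE (bigD1 j) //= mxE (bigD1 i) //= mxE !eqxx mulr1 !big1 ?addr0 //.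
    by move=> r rj; rewrite !mxE big1 ?mul0r // => r' _; rewrite mxE (negPf rj) andbF mulr0.
  by move=> r ri; rewrite mxE (negPf ri) mulr0.
transitivity (\sum_i \sum_p M i p * (E i j) p q); last first.
  rewrite [RHS](eq_bigr (fun w => \sum_i \sum_p M i p * (T w *m delta_mx i j *m T (w^-1)%g) p q)).
    rewrite [RHS]exchange_big /=; apply: eq_bigr => i _; rewrite [RHS]exchange_big /=.
    by apply: eq_bigr => p _; rewrite /E summxE mulr_sumr.
  move=> w _; rewrite mulr_suml; apply: eq_bigr => i _; rewrite mxE mulr_suml.
  by apply: eq_bigr => p _; rewrite entry mulrA.
rewrite (bigD1 j) //= [X in _ + X]big1 ?addr0 => [|i ij]; last first.
  by rewrite big1 // => p _; rewrite (kE (i, j)) k0 // mxE mul0rn mulr0.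
rewrite (bigD1 q) //= [X in _ + X]big1 ?addr0 => [|p pq].
  by rewrite (kE (j, j)) mxE eqxx.
by rewrite (kE (j, j)) mxE (negPf pq) mulr0.
Qed.

Lemma red_trace_dominant x w : (forall a, a \in pos D -> 0 <= coroot D a x) ->
  w x = x -> \tr (red x *m T w) = 0.
Proof.
move=> dom wx; pose t u := \tr (red x *m T u).
have tV u : t (u^-1)%g = - (t u)^*.
  rewrite /t TU -mxtrace_trmxC trmxCM red_adj mulmxN raddfN /= opprK.
  by rewrite mxtrace_mulC.
pose H := \sum_(u <- weyl_enum D | u x == x) t (u^-1)%g *: T u.
(* A correction root [c] is positive with [u c] negative. Dominance gives [c] a nonnegative and
   [u c] a nonpositive coroot value at [x]; as [u] fixes [x] these values agree, so both are
   zero. *)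
have YTx (u : weyl D) : u x = x -> T u *m Y x = Y x *m T u.
  move=> ux; have := T_mulY T1 TM YT u x; rewrite ux big_seq_cond big1 ?addr0 //.
  move=> c /andP[cP ucP]; have cR := pos_root cP.
  suff -> : coroot D c x = 0 by rewrite mulr0 scale0r.
  apply: le_anti; rewrite dom // andbT -(coroot_weyl u) ux -oppr_ge0 -corootN dom //.
  by rewrite posN // weyl_root.
have HY : H *m Y x = Y x *m H.
  rewrite mulmx_suml mulmx_sumr; apply: eq_bigr => u /eqP ux.
  by rewrite -scalemxAl -scalemxAr YTx.
have Hadj : H^t* = - H.
  rewrite /H big_mkcond -[in RHS](sum_weyl_reindex _ (@invgK _) (@invgK _)).
  rewrite trmxC_sum -sumrN; apply: eq_bigr => u _.
  have -> : ((u^-1)%g x == x) = (u x == x).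
    by apply/eqP/eqP => e; rewrite -{1}e ?weylK ?weylKV.
  case: ifP => _; last by rewrite oppr0 trmx0 map_mx0.
  by rewrite invgK trmxCZ -TU tV rmorphN /= conjCK scaleNr.
have rY := skew_trace HY Hadj (@eigenvalue_real x).
have rP : (\tr (H *m P x))^* = - \tr (H *m P x).
  by rewrite -mxtrace_trmxC trmxCM Hadj p_image_adj mulmxN raddfN /= mxtrace_mulC.
have rA : (\tr (H *m red x))^* = \tr (H *m red x).
  by rewrite -mxtrace_trmxC trmxCM Hadj red_adj mulmxN mulNmx opprK mxtrace_mulC.
have AE : \tr (H *m red x) = \tr (H *m Y x) - \tr (H *m P x).
  by rewrite redE mulmxBr raddfB.
(* The trace is real by [rA] and imaginary by [rY] and [rP]. *)
have A0 : \tr (H *m red x) = 0.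
  suff /eqP : \tr (H *m red x) *+ 2 = 0 by rewrite mulrn_eq0 => /eqP.
  rewrite mulr2n -{1}rA AE rmorphB /= rY rP.
  by rewrite opprK addrACA addNr subrr addr0.
have : \sum_(u <- weyl_enum D | u x == x) `|t u| ^+ 2 = 0.
  have trE : \tr (H *m red x) =
      \sum_(u <- weyl_enum D | u x == x) \tr (t (u^-1)%g *: T u *m red x).
    by rewrite mulmx_suml raddf_sum.
  transitivity (- \tr (H *m red x)); last by rewrite A0 oppr0.
  rewrite trE -sumrN; apply: eq_bigr => u _.
  by rewrite -scalemxAl linearZ /= mxtrace_mulC -/(t u) tV normCKC mulNr opprK.
move=> /eqP; rewrite psumr_eq0 => [/allP/(_ w (mem_weyl_enum w))|u _]; last exact: exprn_ge0.
by rewrite wx eqxx /= expf_eq0 /= normr_eq0 => /eqP.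
Qed.

Lemma red_eq0 x : red x = 0.
Proof.
apply: trace_orthogonality => w.
have redD y z : red (y + z) = red y + red z.
  have YD : Y (y + z) = Y y + Y z by rewrite -[y]scale1r Yl !scale1r.
  have PD : P (y + z) = P y + P z by rewrite -[y]scale1r p_image_linear !scale1r.
  by rewrite !redE YD PD opprD addrACA.
have [x0 [y [wx0 ->]]] := fixed_decomposition w x.
(* Conjugating by [w] itself leaves [T w] unchanged, so the component of [x] in the image of [w - 1]
   contributes nothing to the trace. *)
have wy : \tr (red (w y) *m T w) = \tr (red y *m T w).
  by rewrite -(red_trace_conj w y) mulgK.
have red0 : \tr (red (w y - y) *m T w) = 0.
  apply: (addIr (\tr (red y *m T w))).
  by rewrite -mxtraceD -mulmxDl -redD subrK wy add0r.
rewrite redD mulmxDl mxtraceD red0 addr0.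
have [u udom] := dominant_conj x0.
rewrite -(red_trace_conj u); apply: red_trace_dominant => //.
by rewrite !weylME weylK wx0.
Qed.

End Reduced.

Lemma reduced_eq0 x : Y x = P x.
Proof. by apply/eqP; rewrite -subr_eq0 (red_eq0 (red := A)). Qed.

End OneWType.

(** * Unitary coordinates on an irreducible representation *)

Section Coordinates.
Variables (F : fieldType) (X : lmodType F).

(** A spanning family of least size is a basis, and its coordinate map is the required
    isomorphism. *)
Lemma finite_coordinates m (g : 'I_m -> X) :
  (forall x, exists r : 'rV[F]_m, x = \sum_i r 0 i *: g i) ->
  exists d (e : X -> 'rV[F]_d) (e' : 'rV[F]_d -> X),
    [/\ linear e, cancel e e' & cancel e' e].
Proof.
move=> gX; pose Q k := `[< exists b : 'I_k -> X,
  forall x, exists r : 'rV[F]_k, x = \sum_i r 0 i *: b i >].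
have exQ : exists k, Q k by exists m; apply/asboolP; exists g.
case: (ex_minnP exQ) => d /asboolP[b bX] dmin.
pose e' (r : 'rV[F]_d) := \sum_i r 0 i *: b i.
have e'l c r s : e' (c *: r + s) = c *: e' r + e' s.
  rewrite /e' scaler_sumr -big_split /=; apply: eq_bigr => i _.
  by rewrite !mxE scalerA scalerDl.
(* A relation with nonzero coefficient at [i] expresses [b i] through the other vectors, so they
   would span, against minimality. *)
have e'0 s : e' s = 0 -> s = 0.
  move=> es; apply/rowP => i; rewrite mxE; apply/eqP; apply: contraT => si.
  case: d => [|d] in b bX dmin e' e'l s es i si *; first by case: i si.
  have /dmin : Q d; last by rewrite ltnn.
  apply/asboolP; exists (fun j => b (lift i j)) => x; have [r ->] := bX x.
  exists (\row_j (r 0 (lift i j) - r 0 i / s 0 i * s 0 (lift i j))).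
  have -> : \sum_k r 0 k *: b k = e' (- (r 0 i / s 0 i) *: s + r).
    by rewrite e'l es scaler0 add0r.
  rewrite /e' (bigD1_ord i) //= !mxE mulNr divfK // addNr scale0r add0r.
  by apply: eq_bigr => j _; rewrite !mxE addrC mulNr.
have /choice[e eE] : forall x, exists r, x = e' r by exact: bX.
have e'K : cancel e' e.
  move=> r; apply/eqP; rewrite -subr_eq0; apply/eqP/e'0.
  by rewrite -scaleN1r addrC e'l scaleN1r -eE addNr.
exists d, e, e'; split=> // c x y.
by rewrite {1}(eE x) {1}(eE y) -e'l e'K.
Qed.

Lemma can_linear d (e : X -> 'rV[F]_d) (e' : 'rV[F]_d -> X) :
  linear e -> cancel e e' -> cancel e' e -> linear e'.
Proof. by move=> el eK e'K c r s; apply: (can_inj eK); rewrite el !e'K. Qed.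

Lemma linear_rowE (U : lmodType F) d (g : 'rV[F]_d -> U) (r : 'rV[F]_d) : linear g ->
  g r = \sum_j r 0 j *: g (delta_mx 0 j).
Proof.
move=> gl; have g0 : g 0 = 0.
  by have := gl (-1) 0 0; rewrite scaler0 addr0 scaleN1r addNr.
rewrite {1}(row_sum_delta r); elim/big_rec2: _ => // j u s _ <-.
by rewrite gl.
Qed.

Lemma linear_matrix d (e : X -> 'rV[F]_d) (e' : 'rV[F]_d -> X) (f : X -> X) :
  linear e -> cancel e e' -> cancel e' e -> linear f ->
  exists M, forall x, e (f x) = e x *m M.
Proof.
move=> el eK e'K fl; have e'l := can_linear el eK e'K.
exists (\matrix_(i, j) e (f (e' (delta_mx 0 i))) 0 j) => x.
rewrite mulmx_sum_row -{1}(eK x) (linear_rowE (g := fun r => e (f (e' r)))).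
  by apply: eq_bigr => j _; congr (_ *: _); apply/rowP => k; rewrite !mxE.
by move=> c r s; rewrite e'l fl el.
Qed.

End Coordinates.

(** By the spectral theorem [H] is unitarily diagonal with positive entries; [Q] carries their
    square roots. *)
Lemma posdef_factor (C : numClosedFieldType) n (H : 'M[C]_n) : H^t* = H ->
  (forall v : 'rV_n, v != 0 -> 0 < (v *m H *m v^t*) 0 0) ->
  exists2 Q, Q \in unitmx & H = Q *m Q^t*.
Proof.
move=> Hh Hpos.
have /orthomx_spectralP : H \is normalmx by apply/normalmxP; rewrite Hh.
set P := spectralmx H; set d := spectral_diag H => HE.
have Pu : P \is unitarymx := spectral_unitarymx H.
rewrite invmx_unitary // in HE.
have PP : P^t* *m P = 1%:M by apply: mulmx1C; apply/unitarymxP.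
have d0 i : 0 < d 0 i.
  have ri : row i P != 0.
    apply/eqP => ri; have := unitarymxP Pu => /(congr1 (row i)).
    rewrite row_mul ri mul0mx => /rowP/(_ i); rewrite !mxE eqxx => /esym/eqP.
    by rewrite oner_eq0.
  have := Hpos _ ri; rewrite {1}HE rowE trmxCM !mulmxA !mulmxtVK // -rowE row_diag_mx.
  rewrite -scalemxAl mxE mxE (bigD1 i) //= big1 => [|j ji].
    by rewrite !mxE !eqxx /= conjC1 mulr1 addr0 mulr1.
  by rewrite !mxE (negPf ji) andbF mul0r.
pose S := diag_mx (\row_i sqrtC (d 0 i)).
have Sh : S^t* = S.
  apply/matrixP => i j; rewrite !mxE eq_sym; case: eqP => [->|_]; rewrite ?mulr0n ?rmorph0 //.
  by rewrite mulr1n; apply/geC0_conj; rewrite sqrtC_ge0 ltW.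
exists (P^t* *m S).
  rewrite unitmx_mul unitarymx_unit ?trmxC_unitary //= unitmxE det_diag unitfE.
  by apply/prodf_neq0 => i _; rewrite mxE sqrtC_eq0 gt_eqF.
rewrite trmxCM trmxCK Sh {1}HE !mulmxA; congr (_ *m _); rewrite -!mulmxA; congr (_ *m _).
apply/matrixP => i j; rewrite mul_diag_mx !mxE.
case: eqP => [->|_]; rewrite ?mulr0n ?mulr0 // !mulr1n.
by rewrite -expr2 sqrtCK.
Qed.

(* Rows act on the right, hence the inverse in [model_act]. *)
Record unitary_model (R : realType) (V : vectType R) (D : hecke_datum V)
    (X : lmodType R[i]) (sigma : weyl D -> X -> X) := UnitaryModel {
  model_dim : nat;
  coords : X -> 'rV[R[i]]_model_dim.+1;
  uncoords : 'rV[R[i]]_model_dim.+1 -> X;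
  model : weyl D -> 'M[R[i]]_model_dim.+1;
  coords_linear : linear coords;
  coordsK : cancel coords uncoords;
  uncoordsK : cancel uncoords coords;
  model1 : model 1%g = 1;
  modelM : forall w w', model (w * w')%g = model w * model w';
  modelV : forall w, model (w^-1)%g = (model w)^t*;
  model_act : forall w x, coords (sigma w x) = coords x *m model (w^-1)%g;
  model_schur : forall M, (forall w, M *m model w = model w *m M) ->
    exists c, M = c%:M
}.

(** * Existence of unitary models *)

Section Model.
Variables (R : realType) (V : vectType R) (D : hecke_datum V).
Variables (X : lmodType R[i]) (sigma : weyl D -> X -> X).
Hypothesis sP : is_weyl_rep sigma.
Hypothesis irr : irreducible_family sigma.

(** The span of the W-orbit of a nonzero vector is stable, hence everything; the orbit is finite. *)
Lemma irreducible_span : exists m (g : 'I_m -> X),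
  forall x, exists r : 'rV[R[i]]_m, x = \sum_i r 0 i *: g i.
Proof.
have [sl s1 sM] := sP; have [[x0 x0n] stab] := irr.
pose S x := exists c : weyl D -> R[i], x = \sum_(w <- weyl_enum D) c w *: sigma w x0.
have SP : forall x, S x.
  have S0 : S 0 by exists (fun=> 0); rewrite big1 // => w _; rewrite scale0r.
  have [] // := stab S S0 _ _ => [c x y [a ->] [b ->]|u x [a ->]|zero].
  - exists (fun w => c * a w + b w).
    rewrite scaler_sumr -big_split; apply: eq_bigr => w _ /=.
    by rewrite scalerA scalerDl.
  - exists (fun w => a (u^-1 * w)%g).
    rewrite -[RHS](sum_weyl_reindex _ (mulKg u) (mulVKg u)).
    have s0 : sigma u 0 = 0.
      by have := sl u (-1) 0 0; rewrite scaler0 addr0 scaleN1r addNr.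
    elim/big_rec2: _ => // w x1 x2 _ <-.
    by rewrite sl sM mulKg.
  case: x0n; apply: zero; exists (fun w => (w == 1%g)%:R).
  rewrite (bigD1_seq 1%g) ?mem_weyl_enum ?weyl_enum_uniq //= eqxx scale1r s1.
  by rewrite big1 ?addr0 // => w /negPf ->; rewrite scale0r.
exists (size (weyl_enum D)), (fun i => sigma (nth 1%g (weyl_enum D) i) x0) => x.
have [c ->] := SP x; exists (\row_i c (nth 1%g (weyl_enum D) i)).
by rewrite (big_nth 1%g) big_mkord; apply: eq_bigr => i _; rewrite mxE.
Qed.

(** Weyl's unitary trick: averaging over W gives an invariant positive definite matrix [H = Q Q^*],
    and conjugation by [Q] makes the action unitary. *)
Lemma unitary_model_exists : inhabited (unitary_model sigma).
Proof.
have [sl s1 sM] := sP; have [[x0 x0n] stab] := irr.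
have [m [g gX]] := irreducible_span.
have [d [e [e' [el eK e'K]]]] := finite_coordinates gX.
case: d => [|d] in e e' el eK e'K.
  by case: x0n; rewrite -(eK x0) -[RHS]eK; congr e'; apply/rowP => -[].
have /choice[U0 U0E] : forall w, exists M, forall x, e (sigma w x) = e x *m M.
  by move=> w; apply: (linear_matrix el eK e'K).
have ext A B : (forall x, e x *m A = e x *m B) -> A = B.
  by move=> AB; apply/row_matrixP => i; rewrite !rowE -(e'K (delta_mx 0 i)) AB.
have U1 : U0 1%g = 1%:M by apply: ext => x; rewrite -U0E s1 mulmx1.
have UM w w' : U0 (w * w')%g = U0 w' *m U0 w.
  by apply: ext => x; rewrite mulmxA -!U0E sM.
pose H := \sum_(w <- weyl_enum D) U0 w *m (U0 w)^t*.
have HU u : U0 u *m H *m (U0 u)^t* = H.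
  rewrite /H mulmx_sumr mulmx_suml -[RHS](sum_weyl_reindex _ (mulgK u) (mulgVK u)).
  by apply: eq_bigr => w _; rewrite UM trmxCM !mulmxA.
have Hh : H^t* = H.
  by rewrite trmxC_sum; apply: eq_bigr => w _; rewrite trmxCM trmxCK.
have Hpos (v : 'rV_d.+1) : v != 0 -> 0 < (v *m H *m v^t*) 0 0.
  move=> v0; rewrite mulmx_sumr mulmx_suml summxE.
  have vE w : (v *m (U0 w *m (U0 w)^t*) *m v^t*) 0 0 = dotmx (v *m U0 w) (v *m U0 w).
    by rewrite dotmxE trmxCM !mulmxA.
  rewrite (bigD1_seq 1%g) ?mem_weyl_enum ?weyl_enum_uniq //= ltr_wpDr //.
    apply: sumr_ge0 => w _; rewrite vE.
    by have [->|vw] := eqVneq (v *m U0 w) 0; rewrite ?linear0l // ltW // dotmx_is_dotmx.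
  by rewrite vE U1 mulmx1 dotmx_is_dotmx.
have [Q Qu HQ] := posdef_factor Hh Hpos.
(* [U0] reverses products because matrices act on rows from the right; the inverse makes [T]
   multiplicative. *)
have [T TE] : exists T, forall w, T w = invmx Q *m U0 (w^-1)%g *m Q.
  by exists (fun w => invmx Q *m U0 (w^-1)%g *m Q).
have TM w w' : T (w * w')%g = T w *m T w'.
  by rewrite !TE invgM UM !mulmxA mulmxK.
have T1 : T 1%g = 1%:M by rewrite TE invg1 U1 mulmx1 mulVmx.
have TU w : T w *m (T w)^t* = 1%:M.
  have -> : T w *m (T w)^t* = invmx Q *m (U0 (w^-1)%g *m H *m (U0 (w^-1)%g)^t*) *m (invmx Q)^t*.
    by rewrite HQ TE !trmxCM !mulmxA.
  rewrite HU HQ mulmxA mulVmx // mul1mx -trmxCM mulVmx //.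
  by rewrite trmx1 map_mx1.
have TV w : T (w^-1)%g = (T w)^t*.
  by rewrite -[RHS]mul1mx -T1 -(mulVg w) TM -mulmxA TU mulmx1.
pose f x := e x *m Q; pose f' r := e' (r *m invmx Q).
have fl : linear f by move=> c x y; rewrite /f el mulmxDl scalemxAl.
have fK : cancel f f' by move=> x; rewrite /f /f' mulmxK.
have f'K : cancel f' f by move=> r; rewrite /f /f' e'K mulmxKV.
have fact w x : f (sigma w x) = f x *m T (w^-1)%g.
  by rewrite /f TE U0E invgK !mulmxA mulmxK.
clearbody f f'.
(* An eigenspace of [M] is stable under W and nonzero, hence everything. *)
have Tschur (M : 'M_d.+1) : (forall w, M *m T w = T w *m M) -> exists c, M = c%:M.
  move=> MT; have [c /eigenvalueP[v vM v0]] := eigenvalue_closed M (ltn0Sn d).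
  exists c; have f00 : f 0 = 0 by rewrite -(addNr (0 : X)) -scaleN1r fl scaleN1r addNr.
  have [] := stab (fun x => f x *m M = c *: f x) _ _ _ => /= [|a x y Sx Sy|w x Sx|zero|all].
  - by rewrite f00 mul0mx scaler0.
  - by rewrite fl mulmxDl -scalemxAl Sx Sy scalerDr !scalerA mulrC.
  - by rewrite fact -mulmxA -MT mulmxA Sx scalemxAl.
  - have vz : f' v = 0 by apply: zero; rewrite f'K.
    by case/eqP: v0; rewrite -(f'K v) vz f00.
  apply/row_matrixP => i; rewrite !rowE -(f'K (delta_mx 0 i)) all.
  by rewrite f'K mul_mx_scalar.
by constructor; exists d f f' T.
Qed.

End Model.

(** * The Hecke algebra acting on a one W-type module *)

Section HeckeRelations.
Variables (R : realType) (V : vectType R) (D : hecke_datum V).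
Implicit Types (a x y v : V) (w : weyl D).

Lemma hclass_const c : hclass (HK D c) = c%:A.
Proof.
rewrite /GRing.scale /= hclassZ; apply/hclassP/hrel_sym.
exact: hrel_trans (hrel_KC _ _) (hrel_mul1 _).
Qed.

Lemma hclass_add (s t : hterm D) : hclass (HAdd s t) = hclass s + hclass t.
Proof. exact: esym (hclassD s t). Qed.

Lemma hclass_mul (s t : hterm D) : hclass (HMul s t) = hclass s * hclass t.
Proof. exact: esym (hclassM s t). Qed.

Lemma hT1 : hT (1%g : weyl D) = 1.
Proof. exact/hclassP/hrel_T1. Qed.

Lemma hTM w w' : hT (w * w')%g = hT w * hT w'.
Proof. by rewrite -hclass_mul; apply/hclassP/hrel_sym/hrel_TM. Qed.

Lemma hV_linear c (x y : cplx V) : hV D (c *: x + y) = c *: hV D x + hV D y.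
Proof.
rewrite -[c *: hV D x]mulr_algl -hclass_const -hclass_mul -hclass_add.
exact/hclassP/hrel_VD.
Qed.

Lemma cplx_linE c (x y : cplx V) : c *: x + y =
  (complex.Re c *: x.1 - complex.Im c *: x.2 + y.1,
   complex.Re c *: x.2 + complex.Im c *: x.1 + y.2).
Proof. by []. Qed.

Lemma hV_split (z : cplx V) : hV D z = 'i%C *: hreal D z.2 + hreal D z.1.
Proof.
rewrite -hV_linear cplx_linE /= !(scale0r, scale1r, scaler0, subr0, add0r, addr0).
by case: z.
Qed.

Lemma hreal_linear (c : R) x y : hreal D (c *: x + y) = c%:C *: hreal D x + hreal D y.
Proof.
by rewrite -hV_linear cplx_linE /= !(scale0r, scaler0, subr0, addr0).
Qed.

Lemma hrealC x y : hreal D x * hreal D y = hreal D y * hreal D x.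
Proof. by rewrite -!hclass_mul; apply/hclassP/hrel_VC. Qed.

Lemma hreal_T a x : a \in simple D ->
  hreal D x * hT (weyl_refl D a) = hT (weyl_refl D a) * hreal D (weyl_refl D a x)
    + (param D a * coroot D a x)%:C%:A.
Proof.
move=> aS.
have -> : (param D a * coroot D a x)%:C = (param D a)%:C * coroot_pairing D a (of_real x).
  by rewrite coroot_pairing_real [in LHS]rmorphM.
rewrite -hclass_const -!hclass_mul -hclass_add.
have -> : of_real (weyl_refl D a x) = cplx_map (weyl_refl D a) (of_real x).
  by rewrite /cplx_map /of_real /= linear0.
exact/hclassP/hrel_VT.
Qed.

End HeckeRelations.

Section OneWTypeModule.
Variables (R : realType) (V : vectType R) (D : hecke_datum V).
Variables (star : hecke D -> hecke D) (starP : is_star star).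
Variables (X : lmodType R[i]) (act : hecke D -> X -> X).
Hypothesis actP : one_W_type star act.

Lemma act_weyl_rep : is_weyl_rep (fun w : weyl D => act (hT w)).
Proof.
have [[al _ a1 aM] _ _ _] := actP; split=> [w|x|w w' x]; first exact: al.
  by rewrite hT1 a1.
by rewrite hTM aM.
Qed.

Variable m : unitary_model (fun w : weyl D => act (hT w)).
Local Notation e := (coords m).
Local Notation e' := (@uncoords _ _ _ _ _ m).
Local Notation T := (model m).

Lemma matrix_form_ext n (A B : 'M[R[i]]_n) :
  (forall r s : 'rV_n, (r *m A *m s^t*) 0 0 = (r *m B *m s^t*) 0 0) -> A = B.
Proof.
move=> AB; apply/matrixP => i j; have := AB (delta_mx 0 i) (delta_mx 0 j).
have E (M : 'M[R[i]]_n) :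
    ((delta_mx 0 i : 'rV_n) *m M *m (delta_mx 0 j : 'rV_n)^t*) 0 0 = M i j.
  rewrite -rowE mxE (bigD1 j) //= big1 => [|k kj].
    by rewrite !mxE !eqxx /= conjC1 mulr1 addr0.
  by rewrite !mxE (negPf kj) andbF conjC0 mulr0.
by rewrite !E.
Qed.

Lemma hermitian_form_matrix (f : {hermitian_sym X for @conjc R}) :
  exists F, forall x y, f x y = (e x *m F *m (e y)^t*) 0 0.
Proof.
have e'l : linear e' := can_linear (@coords_linear _ _ _ _ _ m)
  (@coordsK _ _ _ _ _ m) (@uncoordsK _ _ _ _ _ m).
have expand x y : f x y = \sum_j e x 0 j * f (e' (delta_mx 0 j)) y.
  rewrite -{1}(@coordsK _ _ _ _ _ m x).
  apply: (linear_rowE (U := R[i]^o) (g := fun r => f (e' r) y)) => c r s.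
  by rewrite e'l linearPl.
have fC x y : f x y = (f y x)^*%C by rewrite hermC expr0 mul1r.
exists (\matrix_(j, k) (f (e' (delta_mx 0 k)) (e' (delta_mx 0 j)))^*%C) => x y.
rewrite expand -mulmxA mxE; apply: eq_bigr => j _; congr (_ * _).
rewrite fC expand rmorph_sum mxE; apply: eq_bigr => k _.
by rewrite !mxE rmorphM mulrC.
Qed.

(** The matrix of the invariant form commutes with W, so it is a scalar by Schur's lemma, nonzero by
    nondegeneracy. Cancelling it turns [star] into the conjugate transpose. *)
Lemma act_matrix_exists : exists mat : hecke D -> 'M[R[i]]_((model_dim m).+1),
  [/\ forall h x, e (act h x) = e x *m mat h,
      forall (c : R[i]) g h, mat (c *: g + h) = c *: mat g + mat h,
      forall g h, mat (g * h) = mat h *m mat g, mat 1 = 1%:M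
    & (forall w, mat (hT w) = T (w^-1)%g) /\ forall h, mat (star h) = (mat h)^t*].
Proof.
have [[al ac a1 aM] [[x0 x0n] _] [f [fnd fadj]] _] := actP.
have [_ _ _ starT _] := starP.
have el : linear e := @coords_linear _ _ _ _ _ m.
have eK : cancel e e' := @coordsK _ _ _ _ _ m.
have e'K : cancel e' e := @uncoordsK _ _ _ _ _ m.
have /choice[mat matE] : forall h, exists M, forall x, e (act h x) = e x *m M.
  by move=> h; apply: (linear_matrix el eK e'K); apply: al.
have ext A B : (forall x, e x *m A = e x *m B) -> A = B.
  by move=> AB; apply/row_matrixP => i; rewrite !rowE -(e'K (delta_mx 0 i)) AB.
have matT w : mat (hT w) = T (w^-1)%g.
  by apply: ext => x; rewrite -matE (@model_act _ _ _ _ _ m).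
have [F FE] := hermitian_form_matrix f.
have FT w : F *m T w = T w *m F.
  apply: matrix_form_ext => r s; have := fadj (hT (w^-1)%g) (e' r) (e' s).
  rewrite starT !FE !matE !e'K !matT invgK trmxCM -(@modelV _ _ _ _ _ m) !mulmxA invgK.
  by move=> <-.
have [c Fc] := @model_schur _ _ _ _ _ m F FT.
have c0 : c != 0.
  apply/eqP => cz; apply: x0n; apply: fnd => y.
  by rewrite FE Fc cz mul_mx_scalar scale0r mul0mx mxE.
exists mat; split=> // [a g h|g h||].
- by apply: ext => x; rewrite -matE ac el !matE mulmxDr scalemxAr.
- by apply: ext => x; rewrite -matE aM !matE mulmxA.
- by apply: ext => x; rewrite -matE a1 mulmx1.
split=> // h; rewrite -[LHS]trmxCK; congr (_ ^t*).
apply: matrix_form_ext => r s; apply: (mulfI c0).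
have := fadj h (e' r) (e' s); rewrite !FE !matE !e'K Fc trmxCM !mul_mx_scalar -!scalemxAl.
by rewrite [LHS]mxE [RHS]mxE mulmxA => ->.
Qed.

Lemma one_W_type_hreal v x : e (act (hreal D v) x) = e x *m p_image T v /\
  e (act (star (hreal D v)) x) = e x *m p_image T v.
Proof.
have [mat [matE matl matM mat1 [matT matS]]] := act_matrix_exists.
have [_ _ _ _ star_real] := starP.
have T1 := @model1 _ _ _ _ _ m; have TM := @modelM _ _ _ _ _ m.
have TV := @modelV _ _ _ _ _ m.
have matN h : mat (- h) = - mat h.
  have mat0 : mat 0 = 0.
    by rewrite -(addNr 0) -scaleN1r matl scaleN1r addNr.
  by rewrite -[- h]addr0 -scaleN1r matl mat0 addr0 scaleN1r.
have matD g h : mat (g + h) = mat g + mat h by rewrite -[g]scale1r matl !scale1r.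
have matK c : mat c%:A = c%:M.
  have mat0 : mat 0 = 0 by rewrite -(addNr 0) matD matN addNr.
  by rewrite -[c%:A]addr0 matl mat0 addr0 mat1 scalemx1.
pose Y v := mat (hreal D v).
(* [mat] reverses products, so the relation comes out in the required order when applied at [s_a y];
   the sign of the reflected coroot value then restores the scalar term. *)
have YT a y : a \in simple D -> Y y * T (weyl_refl D a) =
    T (weyl_refl D a) * Y (weyl_refl D a y) + (param D a * coroot D a y)%:C%:A.
  move=> aS; have aR := simple_roots aS.
  have sK : weyl_refl D a (weyl_refl D a y) = y by rewrite -weylME weyl_refl_sq ?weyl1E.
  have := congr1 mat (hreal_T (weyl_refl D a y) aS).
  rewrite matD !matM !matT weyl_refl_inv // sK matK coroot_refl // mulrN rmorphN.
  rewrite -!mulmxE -[X in _ = _ + X]scalemx1 => ->.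
  by rewrite scaleNr subrK.
have Yl c y z : Y (c *: y + z) = c%:C *: Y y + Y z by rewrite /Y hreal_linear matl.
have YC y z : Y y *m Y z = Y z *m Y y by rewrite /Y -!matM hrealC.
have Yadj y : (Y y)^t* = - (T (weyl_longest D) * Y (longest D y) * T (weyl_longest D)).
  by rewrite /Y -matS star_real matN !matM matT weyl_longest_inv -!mulmxE mulmxA.
have YE := reduced_eq0 T1 TM YT Yl YC TV (@model_schur _ _ _ _ _ m) Yadj v.
rewrite !matE matS -[mat (hreal D v)]/(Y v) YE; split=> //.
by rewrite (p_image_adj TV).
Qed.

Lemma one_W_type_tilde v x : act (tilde star v) x = 0.
Proof.
have [[al ac _ _] _ _ _] := actP.
have act0 y : act 0 y = 0 by rewrite -(addNr 0) -scaleN1r ac scaleN1r addNr.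
have el : linear e := @coords_linear _ _ _ _ _ m.
have e0 : e 0 = 0 by rewrite -(addNr 0) -scaleN1r el scaleN1r addNr.
apply: (can_inj (@coordsK _ _ _ _ _ m)).
rewrite /tilde -[_ *: _]addr0 ac act0 addr0.
have [e1 e2] := one_W_type_hreal v x.
rewrite addrC -scaleN1r ac -[_ *: _]addr0 el e0 addr0 el e1 e2.
by rewrite scaleN1r addNr scaler0.
Qed.

End OneWTypeModule.

(** * Extending a representation of the Weyl group *)

Section PullbackForm.
Variables (C : numClosedFieldType) (X : lmodType C) (n : nat) (e : X -> 'rV[C]_n).
Hypothesis el : linear e.

(** The linearity proof is an argument so that the bilinear and hermitian structures can be attached
    to the form. *)
Definition pullback_form (_ : linear e) := fun x y : X => (e x *m (e y)^t*) 0 0 : C.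

Local Notation form := (pullback_form el).

Fact pullback_form_bilinear : bilinear_for
  (GRing.Scale.Law.clone _ _ ( *%R ) _) (GRing.Scale.Law.clone _ _ (Num.conj \; *%R) _) form.
Proof.
split=> [y|x] c u v; rewrite /pullback_form el.
  by rewrite mulmxDl -scalemxAl mxE [X in X + _]mxE.
by rewrite trmxCD trmxCZ mulmxDr -scalemxAr mxE [X in X + _]mxE.
Qed.

HB.instance Definition _ := bilinear_isBilinear.Build C X X _ _ _ form pullback_form_bilinear.

Fact pullback_form_hermitian x y : form x y = (-1) ^+ false * Num.conj (form y x).
Proof.
rewrite expr0 mul1r /pullback_form -[in LHS](trmxCK (e x)) -trmxCM.
by rewrite [LHS]mxE mxE.
Qed.

HB.instance Definition _ := isHermitianSesquilinear.Build C X false Num.conj form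
  pullback_form_hermitian.

End PullbackForm.

Section RepP.
Variables (R : realType) (V : vectType R) (D : hecke_datum V).
Variables (X : lmodType R[i]) (sigma : weyl D -> X -> X).

(** [p_image] involves reflections only, and these are involutions, so the inverse in [model_act]
    disappears. *)
Lemma coords_rep_p (m : unitary_model sigma) v x :
  coords m (rep_p sigma v x) = coords m x *m p_image (model m) v.
Proof.
have el : linear (coords m) := @coords_linear _ _ _ _ _ m.
rewrite /rep_p (p_image_map (f := coords m)); last by move=> c y z; apply: el.
rewrite (p_image_map (f := mulmx (coords m x))); last first.
  by move=> c A B; rewrite mulmxDr scalemxAr.
by apply: p_image_ext => a aR; rewrite (@model_act _ _ _ _ _ m) weyl_refl_inv.
Qed.

End RepP.

Section Extension.
Variables (R : realType) (V : vectType R) (D : hecke_datum V).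
Variables (X : lmodType R[i]) (sigma : weyl D -> X -> X).
Hypothesis sP : is_weyl_rep sigma.
Hypothesis comm : forall (v1 v2 : V) (x : X),
  rep_p sigma v1 (rep_p sigma v2 x) - rep_p sigma v2 (rep_p sigma v1 x) = 0.

(** The action is defined on terms first, with omega acting by p_omega extended complex-linearly;
    [term_act_rel] lets it descend to the quotient. *)
Fixpoint term_act (t : hterm D) (x : X) : X :=
  match t with
  | HK c => c *: x
  | HT w => sigma w x
  | HV z => rep_p sigma z.1 x + 'i%C *: rep_p sigma z.2 x
  | HAdd s t => term_act s x + term_act t x
  | HMul s t => term_act s (term_act t x)
  end.

Lemma rep_p_linear v : linear (rep_p sigma v).
Proof.
have [sl _ _] := sP; move=> c x y; rewrite /rep_p /p_image scalerA mulrC -scalerA -scalerDr.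
congr (_ *: _); rewrite scaler_sumr -big_split; apply: eq_bigr => a _ /=.
by rewrite sl scalerDr !scalerA mulrC.
Qed.

Lemma rep_p_real c v v' x :
  rep_p sigma (c *: v + v') x = c%:C *: rep_p sigma v x + rep_p sigma v' x.
Proof. exact: p_image_linear. Qed.

Lemma term_act_linear t : linear (term_act t).
Proof.
have [sl _ _] := sP; elim: t => [d|w|z|s IHs t IHt|s IHs t IHt] c x y /=.
- by rewrite scalerDr !scalerA mulrC.
- exact: sl.
- rewrite !rep_p_linear; move: (rep_p _ _ x) (rep_p _ _ y) (rep_p _ _ x) (rep_p _ _ y).
  by move=> ? ? ? ?; rewrite !scalerDr !scalerA (mulrC c) addrACA.
- by rewrite IHs IHt scalerDr addrACA.
- by rewrite IHt IHs.
Qed.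

Lemma rep_p_complex a (z z' : cplx V) x : term_act (HV D (a *: z + z')) x =
  a *: term_act (HV D z) x + term_act (HV D z') x.
Proof.
rewrite cplx_linE /= -scaleNr -!addrA !rep_p_real.
move: (rep_p _ z.1 x) (rep_p _ z.2 x) (rep_p _ z'.1 x) (rep_p _ z'.2 x) => A B A' B'.
have aE : a = (complex.Re a)%:C + 'i%C * (complex.Im a)%:C.
  case: a => p q; apply/eqP; rewrite eq_complex /=.
  by rewrite !(mulr0, mul0r, mul1r, subr0, addr0, add0r) !eqxx.
have ai : a * 'i%C = (- complex.Im a)%:C + 'i%C * (complex.Re a)%:C.
  case: a {aE} => p q; apply/eqP; rewrite eq_complex /=.
  by rewrite !(mulr0, mul0r, mul1r, mulr1, subr0, sub0r, addr0, add0r) !eqxx.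
rewrite [in RHS]scalerDr scalerA ai [in a *: A]aE !scalerDr !scalerDl !scalerA !addrA.
by rewrite [LHS](ACl (1 * 5 * 2 * 4 * 3 * 6))%AC.
Qed.

(** The cross relation with p_omega in place of omega; it restates [p_image_conj_simple], applied to
    the translate of [sigma] by [s]. *)
Lemma rep_p_simple a v x : a \in simple D ->
  rep_p sigma v (sigma (weyl_refl D a) x) =
  sigma (weyl_refl D a) (rep_p sigma (weyl_refl D a v) x) + (param D a * coroot D a v)%:C *: x.
Proof.
move=> aS; have [sl s1 sM] := sP; have aR := simple_roots aS.
set s := weyl_refl D a.
have ss : (s * s = 1)%g := weyl_refl_sq aR.
have := p_image_conj_simple (fun w => sigma (w * s)%g x) (s v) aS.
rewrite -/s -[s (s v)]weylME ss weyl1E coroot_refl // mulrN rmorphN scaleNr s1.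
rewrite {1}/rep_p (p_image_ext (T' := fun w => sigma s (sigma w x))); last first.
  by move=> b _; rewrite -!mulgA ss mulg1 sM.
rewrite -(p_image_map (f := sigma s)); last exact: sl.
move=> e.
rewrite [sigma s (rep_p _ _ _)]e subrK.
by apply: p_image_ext => b _; rewrite sM.
Qed.

(** By this rule omega^* also acts by p_omega, in agreement with the self-adjointness of p_omega. *)
Lemma rep_p_longest v x : sigma (weyl_longest D)
  (rep_p sigma (longest D v) (sigma (weyl_longest D) x)) = - rep_p sigma v x.
Proof.
have [sl s1 sM] := sP; set w0 := weyl_longest D.
have w0K : longest D (longest D v) = v.
  by rewrite -[longest D _]/(w0 (w0 v)) -weylME weyl_longest_sq weyl1E.
have := p_image_conj_longest (fun w => sigma w x) (longest D v); rewrite w0K => <-.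
rewrite /rep_p (p_image_map (f := sigma w0)); last exact: sl.
apply: p_image_ext => b _.
by rewrite !sM.
Qed.

Lemma rep_pDZ v c x y : rep_p sigma v (x + c *: y) = rep_p sigma v x + c *: rep_p sigma v y.
Proof. by rewrite addrC rep_p_linear addrC. Qed.

Lemma rep_pC v v' x : rep_p sigma v (rep_p sigma v' x) = rep_p sigma v' (rep_p sigma v x).
Proof. by apply/eqP; rewrite -subr_eq0 comm. Qed.

Lemma coroot_pairing_split a (z : cplx V) :
  coroot_pairing D a z = (coroot D a z.1)%:C + 'i%C * (coroot D a z.2)%:C.
Proof.
rewrite /coroot_pairing /coroot -fmorphV; apply/eqP; rewrite eq_complex /=.
rewrite !(mulr0, mul0r, addr0, add0r, subr0, mul1r) -[1 + 1]/2%:R.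
by rewrite !eqxx.
Qed.

Lemma term_act_rel s t : hrel s t -> forall x, term_act s x = term_act t x.
Proof.
have [sl s1 sM] := sP.
elim=> {s t} //=.
- by move=> s t u _ st _ tu x; rewrite st.
- by move=> s s' t t' _ ss' _ tt' x; rewrite ss' tt'.
- by move=> s s' t t' _ ss' _ tt' x; rewrite tt' ss'.
- by move=> *; rewrite addrA.
- by move=> *; rewrite addrC.
- by move=> *; rewrite scale0r add0r.
- by move=> *; rewrite scaleN1r addNr scale0r.
- by move=> *; rewrite scale1r.
- by move=> s t u x; rewrite -[term_act t x]scale1r term_act_linear !scale1r.
- by move=> *; rewrite scalerDl.
- by move=> *; rewrite scalerA.
- move=> a s x; rewrite -[a *: x]addr0 term_act_linear.
  have t0 : term_act s 0 = 0.
    by have := term_act_linear s (-1) 0 0; rewrite scaler0 addr0 scaleN1r addNr.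
  by rewrite t0 addr0.
- by move=> x; rewrite s1 scale1r.
- by move=> a z z' x; apply: rep_p_complex.
(* Commutativity of V: the hypothesis [comm] enters here through [rep_pC]. *)
- move=> z z' x; rewrite !rep_pDZ (rep_pC z'.1 z.1) (rep_pC z'.1 z.2).
  rewrite (rep_pC z'.2 z.1) (rep_pC z'.2 z.2).
  move: (rep_p _ z.1 (rep_p _ z'.1 x)) (rep_p _ z.1 (rep_p _ z'.2 x)).
  move: (rep_p _ z.2 (rep_p _ z'.1 x)) (rep_p _ z.2 (rep_p _ z'.2 x)) => A B E G.
  by rewrite !scalerDr addrACA.
move=> a z aS x; rewrite !rep_p_simple // coroot_pairing_split.
have sDZ c y y' : sigma (weyl_refl D a) (y + c *: y') =
    sigma (weyl_refl D a) y + c *: sigma (weyl_refl D a) y'.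
  by rewrite addrC sl addrC.
rewrite sDZ; move: (sigma _ _) (sigma _ _) => A B.
rewrite scalerDr addrACA; congr (_ + _).
by rewrite mulrDr scalerDl !scalerA !(rmorphM _ (param D a)) mulrCA.
Qed.

Definition hecke_act (h : hecke D) (x : X) : X := term_act (repr h) x.

Lemma hecke_act_class t x : hecke_act (hclass t) x = term_act t x.
Proof. exact/term_act_rel/hrepr_class. Qed.

Lemma hecke_act_lin c g h x :
  hecke_act (c *: g + h) x = c *: hecke_act g x + hecke_act h x.
Proof.
elim/hclass_ind: g => s; elim/hclass_ind: h => t.
have -> : c *: hclass s + hclass t = hclass (HAdd (HMul (HK D c) s) t).
  by rewrite hclass_add hclass_mul hclass_const mulr_algl.
by rewrite !hecke_act_class.
Qed.

Lemma hecke_act_module : is_hecke_module hecke_act.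
Proof.
split=> [h|c g h x|x|g h x].
- exact: term_act_linear.
- exact: hecke_act_lin.
- by rewrite -[1]/(hclass (HK D 1)) hecke_act_class /= scale1r.
elim/hclass_ind: g => s; elim/hclass_ind: h => t.
by rewrite -hclass_mul !hecke_act_class.
Qed.

Variables (star : hecke D -> hecke D) (starP : is_star star).
Variable m : unitary_model sigma.

Let form : {hermitian_sym X for @conjc R} := pullback_form (@coords_linear _ _ _ _ _ m).

Lemma hecke_act_real v x : hecke_act (hreal D v) x = rep_p sigma v x.
Proof.
have r0 : rep_p sigma 0 x = 0.
  have := rep_p_real 1 0 0 x; rewrite scaler0 addr0 scale1r => /eqP.
  by rewrite -subr_eq subrr eq_sym => /eqP.
by rewrite hecke_act_class /= r0 scaler0 addr0.
Qed.

Lemma hecke_act_star_real v x : hecke_act (star (hreal D v)) x = rep_p sigma v x.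
Proof.
have [_ _ _ _ ->] := starP; have [_ _ _ actM] := hecke_act_module.
have act0 y : hecke_act 0 y = 0.
  by have := hecke_act_lin (-1) 0 0 y; rewrite scaler0 addr0 scaleN1r addNr.
rewrite -[- _]addr0 -scaleN1r hecke_act_lin act0 addr0 !actM hecke_act_real.
by rewrite !hecke_act_class /= rep_p_longest scaleN1r opprK.
Qed.

Lemma form_rep_p v x y :
  pullback_form (@coords_linear _ _ _ _ _ m) (rep_p sigma v x) y =
  pullback_form (@coords_linear _ _ _ _ _ m) x (rep_p sigma v y).
Proof.
rewrite /pullback_form !coords_rep_p trmxCM (p_image_adj (@modelV _ _ _ _ _ m)).
by rewrite mulmxA.
Qed.

Lemma star1 : star 1 = 1.
Proof. by have [_ _ _ sT _] := starP; rewrite -(hT1 D) sT invg1. Qed.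

(** Sums and products reduce this to generators: [t_w] acts unitarily, while omega and omega^* both
    act by the self-adjoint operator p_omega. *)
Lemma term_act_star t x y :
  form (term_act t x) y = form x (hecke_act (star (hclass t)) y).
Proof.
have [sl sM _ sT _] := starP; have [_ _ act1 actM] := hecke_act_module.
have s0 : star 0 = 0.
  have := sl 1 0 0; rewrite scaler0 addr0 conjc1 scale1r => /eqP.
  by rewrite -subr_eq subrr eq_sym => /eqP.
have act0 z : hecke_act 0 z = 0.
  by have := hecke_act_lin (-1) 0 0 z; rewrite scaler0 addr0 scaleN1r addNr.
have actZ c h z : hecke_act (c *: h) z = c *: hecke_act h z.
  by rewrite -[c *: h]addr0 hecke_act_lin act0 addr0.
have sZ c h : star (c *: h) = conjc c *: star h.
  by rewrite -[c *: h]addr0 sl s0 addr0.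
have sD g h : star (g + h) = star g + star h.
  by rewrite -[g]scale1r sl conjc1 !scale1r.
have actD g h z : hecke_act (g + h) z = hecke_act g z + hecke_act h z.
  by rewrite -[g]scale1r hecke_act_lin !scale1r.
elim: t x y => [c|w|z|s IHs t IHt|s IHs t IHt] x y.
- by rewrite hclass_const sZ star1 actZ act1 linearZl_LR linearZr_LR /= conjcK.
- rewrite -[hclass _]/(hT w) sT hecke_act_class /= /pullback_form !model_act invgK.
  by rewrite trmxCM -modelV mulmxA.
- rewrite -[hclass _]/(hV D z) hV_split sD sZ actD actZ !hecke_act_star_real.
  rewrite -[term_act _ x]/(rep_p sigma z.1 x + 'i%C *: rep_p sigma z.2 x).
  have fl c u u' : form (u + c *: u') y = form u y + c * form u' y.
    by rewrite linearDl linearZl_LR.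
  have fr c u u' : form x (c *: u' + u) = conjc c * form x u' + form x u.
    by rewrite linearDr linearZr_LR.
  have frep v u u' : form (rep_p sigma v u) u' = form u (rep_p sigma v u').
    exact: form_rep_p.
  by rewrite fl fr conjcK !frep addrC.
- rewrite hclass_add sD actD -[term_act _ x]/(term_act s x + term_act t x).
  transitivity (form (term_act s x) y + form (term_act t x) y); first exact: linearDl.
  by rewrite IHs IHt; apply/esym/linearDr.
- rewrite hclass_mul sM actM -[term_act _ x]/(term_act s (term_act t x)).
  by rewrite IHs IHt.
Qed.

(** A subspace stable under the algebra is stable under W, so irreducibility is inherited; the form
    is positive definite, hence nondegenerate. *)
Lemma hecke_act_one_W_type : irreducible_family sigma -> one_W_type star hecke_act.
Proof.
move=> irr; have actT w x : hecke_act (hT w) x = sigma w x by rewrite hecke_act_class.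
have [nz stab] := irr.
split; first exact: hecke_act_module.
- split=> // S S0 Sl Sact; apply: stab => // w x Sx.
  by rewrite -actT; apply: Sact.
- exists form; split=> [x xy|h x y]; last first.
    by elim/hclass_ind: h => t; rewrite hecke_act_class term_act_star.
  apply: contrapT => x0; have ex : coords m x != 0.
    apply/eqP => ex; apply: x0; apply: (can_inj (@coordsK _ _ _ _ _ m)).
    rewrite ex; apply/esym.
    have := @coords_linear _ _ _ _ _ m (-1) 0 0.
    by rewrite scaler0 addr0 scaleN1r addNr.
  by have := dotmx_is_dotmx ex; rewrite dotmxE -[_ 0 0]/(form x x) xy ltxx.
- split=> // S S0 Sl Sact; apply: stab => // w x Sx.
  by rewrite -actT; apply: Sact.
Qed.

End Extension.

Close Scope sesquilinear_scope.
Close Scope complex_scope.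

Theorem proposition3p1p1 (R : realType) (V : vectType R) (D : hecke_datum V)
    (star : hecke D -> hecke D) (starP : is_star star) :
  (forall (X : lmodType R[i]) (act : hecke D -> X -> X),
     one_W_type star act ->
     forall (v : V) (x : X), act (tilde star v) x = 0)
  /\
  (forall (X : lmodType R[i]) (sigma : weyl D -> X -> X),
     is_weyl_rep sigma -> irreducible_family sigma ->
     (exists act : hecke D -> X -> X,
        one_W_type star act /\
        forall (w : weyl D) (x : X), act (hT w) x = sigma w x)
     <->
     (forall (v1 v2 : V) (x : X),
        rep_p sigma v1 (rep_p sigma v2 x) - rep_p sigma v2 (rep_p sigma v1 x)
        = 0)).
Proof.
have model_of (X : lmodType R[i]) (act : hecke D -> X -> X) :
    one_W_type star act -> inhabited (unitary_model (fun w : weyl D => act (hT w))).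
  move=> actP; have [_ _ _ irr] := actP.
  exact: unitary_model_exists (act_weyl_rep actP) irr.
split=> [X act actP v x|X sigma sP irr].
  by have [m] := model_of X act actP; apply: (one_W_type_tilde starP actP m).
split=> [[act [actP actT]] v1 v2 x|comm].
  have [m] := model_of X act actP.
  have [[_ _ _ aM] _ _ _] := actP.
  (* On the given module omega acts by p_omega, so the commutator is the action of a commutator in
     V, which vanishes. *)
  have repE v y : rep_p sigma v y = act (hreal D v) y.
    apply: (can_inj (@coordsK _ _ _ _ _ m)).
    rewrite (one_W_type_hreal starP actP m v y).1 -coords_rep_p; congr (coords m _).
    by apply: p_image_ext => a _; rewrite actT.
  by rewrite !repE -!aM hrealC subrr.
have [m] := unitary_model_exists sP irr.
exists (hecke_act sigma); split; first exact: hecke_act_one_W_type.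
by move=> w x; rewrite hecke_act_class.
Qed.
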